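(* For every $\alpha>0$ there exists a constant $\beta>0$ such that for every $n$-vertex cyclically $4$-edge-connected cubic graph $G$ and every edge $e$ of $G$, the number of perfect matchings of $G$ not containing $e$ is at least $\alpha n-\beta$.
   Context: Graphs may have parallel edges. For a partition $\{A,B\}$ of $V(G)$, $E(A,B)$ denotes the set of edges with one end in $A$ and one in $B$; it is a $k$-edge-cut if it has exactly $k$ edges. An edge-cut $E(A,B)$ is cyclic if both $G[A]$ and $G[B]$ contain a cycle. A graph is cyclically $k$-edge-connected if it has no cyclic edge-cut with fewer than $k$ edges. *)

(* Defs.v *)
From mathcomp Require Import all_boot.
From Stdlib Require Import Reals.
Set Implicit Arguments. Unset Strict Implicit. Unset Printing Implicit Defensive.

(* A finite loopless multigraph: vertex type V, edge type E, and each edge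
   has an (unordered) pair of endpoints given by [ends e = (u, v)].
   Parallel edges are allowed (distinct edges may have the same ends). *)

Definition loopless (V E : finType) (ends : E -> V * V) : Prop :=
  forall e : E, (ends e).1 != (ends e).2.

Definition incident (V E : finType) (ends : E -> V * V) (v : V) (e : E) : bool :=
  ((ends e).1 == v) || ((ends e).2 == v).

Definition joins (V E : finType) (ends : E -> V * V) (e : E) (u v : V) : bool :=
  (ends e == (u, v)) || (ends e == (v, u)).

Definition degree (V E : finType) (ends : E -> V * V) (v : V) : nat :=
  #|[set e : E | incident ends v e]|.

Definition cubic (V E : finType) (ends : E -> V * V) : Prop :=
  forall v : V, degree ends v = 3.

(* G[A] contains a cycle: a cyclic sequence of k >= 2 distinct vertices of A
   joined consecutively by k distinct edges (k = 2: two parallel edges). *)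
Definition has_cycle_in (V E : finType) (ends : E -> V * V) (A : {set V}) : Prop :=
  exists (k : nat) (vs : 'I_k.+2 -> V) (es : 'I_k.+2 -> E),
    injective vs /\ injective es /\
    (forall i, vs i \in A) /\
    (forall i : 'I_k.+2, joins ends (es i) (vs i) (vs (ordS i))).

Definition edge_cut (V E : finType) (ends : E -> V * V) (A : {set V}) : {set E} :=
  [set e : E | (((ends e).1 \in A) && ((ends e).2 \notin A))
            || (((ends e).1 \notin A) && ((ends e).2 \in A))].

Definition cyclic_cut (V E : finType) (ends : E -> V * V) (A : {set V}) : Prop :=
  has_cycle_in ends A /\ has_cycle_in ends (~: A).

Definition cyclically_k_edge_connected (V E : finType) (ends : E -> V * V) (k : nat) : Prop :=
  forall A : {set V}, cyclic_cut ends A -> k <= #|edge_cut ends A|.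

Definition perfect_matching (V E : finType) (ends : E -> V * V) (M : {set E}) : bool :=
  [forall v : V, #|[set e in M | incident ends v e]| == 1].

Definition num_pm_avoiding (V E : finType) (ends : E -> V * V) (e : E) : nat :=
  #|[set M : {set E} | perfect_matching ends M && (e \notin M)]|.

(* Main.v *)
Require Import Defs.
From mathcomp Require Import all_boot all_order all_algebra.
From mathcomp Require Import ring lra zify.
From mathcomp Require Import boolp.
Set Implicit Arguments. Unset Strict Implicit. Unset Printing Implicit Defensive.
Import Order.TTheory GRing.Theory Num.Theory.

(**
In a cyclically 4-edge-connected cubic graph every odd edge-cut other than a
vertex star has at least five edges.  Hence the constant vector 1/3, perturbed by
a vector that sums to zero at every vertex and has entries of modulus at most
2/15, satisfies Edmonds' inequalities: its entries are at least 1/5.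

A gadget is a set U with a vertex w such that, for each of the three edges f at w,
some zero-sum perturbation supported inside U lowers f by 2/15.  Perturbations in
disjoint gadgets can be superposed, so given J disjoint gadgets avoiding e and a
choice s(i) of an edge at each w_i, there is a point of the perfect matching
polytope of value 1/5 on every s(i) and 1/3 on e.  Minimising
|M inter s| + (J/3)[e in M] yields a perfect matching M of value at most
J/5 + J/9 = 14J/45 < J/3, so M avoids e and meets s in at most 14J/45 edges.  As
a fixed matching meets a random s in J/3 edges on average, a Chernoff bound makes
the number of matchings needed for all 3^J choices exponential in J.

Finally, J may be taken of order sqrt n: cut the graph into connected clusters of
about sqrt n vertices.  A cluster with a small boundary contains a gadget, since
it has many more edges than vertices; if many clusters have large boundaries, some
two of them are joined by five edges, and their union contains a bipartite theta
graph, which is a gadget as well.  An exponential in sqrt n beats every linear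
function.
*)


(** * Boundaries of vertex sets and sums over stars *)

Section Boundary.
Variables (V E : finType) (ends : E -> V * V).

(** Edmonds' theorem enters in the form that, for each linear cost, some perfect matching inside the
    support of the fractional point does at least as well as that point. One matching for one cost
    is all that is needed, and no convex decomposition has to be carried through a contraction. To
    compare matchings on both sides of a tight cut the edge type stays fixed: contraction only
    changes [ends], and contracted edges survive as loops. Hence [bd] is an exclusive or, false on
    loops.

    The size s of the clusters is dictated by a count. A gadget-free cluster has a boundary of at
    least a fifteenth of its order, so the boundaries have total size linear in n. If any two of the
    at most n/s clusters are joined by at most four edges, this total is at most of order (n/s)^2.
    The two collide once s is a large multiple of sqrt n.

    All three edges at w must be lowerable: a perfect matching uses exactly one of them, and only a
    free choice among all three gives every matching the same average of J/3 hits. *)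

Definition bd (X : {set V}) (f : E) : bool :=
  ((ends f).1 \in X) (+) ((ends f).2 \in X).

Definition ins (X : {set V}) (f : E) : bool :=
  ((ends f).1 \in X) && ((ends f).2 \in X).

Lemma bdC X f : bd (~: X) f = bd X f.
Proof. by rewrite /bd !inE; do 2 case: (_ \in X). Qed.

Lemma bd_ins X f : bd X f -> ins X f = false.
Proof. by rewrite /bd /ins; do 2 case: (_ \in X). Qed.

Lemma bd_loop X f : (ends f).1 = (ends f).2 -> bd X f = false.
Proof. by rewrite /bd => ->; rewrite addbb. Qed.

Lemma star_card (X : {set V}) (f : E) : (ends f).1 != (ends f).2 ->
  (\sum_(v in X) bd [set v] f = ((ends f).1 \in X) + ((ends f).2 \in X))%N.
Proof.
move=> npq.
rewrite (eq_bigr (fun v => ((ends f).1 == v) + ((ends f).2 == v)))%N; last first.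
  move=> w _; rewrite /bd !inE.
  case: eqP => [e1|_]; case: eqP => [e2|_] //.
  by move: npq; rewrite e1 e2 eqxx.
rewrite big_split /=.
have aux u : (\sum_(i in X) (u == i) = (u \in X))%N.
  case: (boolP (u \in X)) => uX.
    rewrite (bigD1 u) //= eqxx big1 ?addn0 // => i /andP[_].
    by rewrite eq_sym => /negbTE ->.
  by rewrite big1 // => i iX; case: eqP => // e; rewrite e iX in uX.
by rewrite !aux.
Qed.

Local Open Scope ring_scope.

(** Double counting of edge ends. A loop in [X] would count twice on the right and never on the
    left, hence the assumption on [F]. *)
Lemma star_sum (X : {set V}) (F : E -> rat) :
  (forall f, (ends f).1 = (ends f).2 -> F f = 0) ->
  \sum_(v in X) \sum_(f | bd [set v] f) F f =
  \sum_f F f * (((ends f).1 \in X)%:R + ((ends f).2 \in X)%:R).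
Proof.
move=> F0.
under eq_bigr do rewrite big_mkcond /=.
rewrite exchange_big /=; apply: eq_bigr => f _.
case: (eqVneq (ends f).1 (ends f).2) => [e|npq].
  by rewrite F0 // mul0r big1 // => v _; rewrite bd_loop.
rewrite (eq_bigr (fun v => F f * (bd [set v] f)%:R)); last first.
  by move=> v _; case: (bd _ f); rewrite ?mulr1 ?mulr0.
by rewrite -mulr_sumr -natr_sum star_card // natrD.
Qed.

End Boundary.

(** * Moving to a face of a polyhedron; kernel vectors *)

Section Move.
Local Open Scope ring_scope.

(** The ratio test of the simplex method: [s] is the least [a i / - b i] over the decreasing
    coordinates, and a minimiser is the coordinate that vanishes. *)
Lemma move_to_boundary (I : finType) (a b : I -> rat) :
  (forall i, 0 <= a i) -> (exists i, b i < 0) ->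
  exists s, [/\ 0 <= s, forall i, 0 <= a i + s * b i &
                exists2 i, b i < 0 & a i + s * b i = 0].
Proof.
move=> a0 [i0 bi0].
case: (@Order.TotalTheory.arg_minP _ _ I i0 (fun i => b i < 0)
         (fun i => a i / - b i) bi0) => i bi mini.
exists (a i / - b i); split.
- by rewrite divr_ge0 // oppr_ge0 ltW.
- move=> j; case: (ltP (b j) 0) => bj.
    have := mini j bj; rewrite ler_pdivlMr ?oppr_gt0 // mulrN; lra.
  by rewrite addr_ge0 // mulr_ge0 // divr_ge0 // oppr_ge0 ltW.
- by exists i => //; rewrite invrN mulrN mulNr divfK ?subrr // lt_eqF.
Qed.

Lemma kernel_vector (I J : finType) (a : I -> J -> rat) (A : {set I}) (B : {set J}) :
  (#|B| < #|A|)%N ->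
  exists y : I -> rat, [/\ exists i, y i != 0, forall i, i \notin A -> y i = 0 &
    forall j, j \in B -> \sum_i y i * a i j = 0].
Proof.
move=> cAB.
have [i0 Ai0] : exists i0, i0 \in A by apply/card_gt0P; apply: leq_ltn_trans cAB.
pose M := \matrix_(i < #|A|, j < #|B|) a (enum_val i) (enum_val j).
have : kermx M != 0.
  rewrite kermx_eq0 /row_free; apply: contraTneq cAB => <-.
  by rewrite -leqNgt rank_leq_col.
case/rowV0Pn => u uK u0.
have uM : u *m M = 0 by apply/sub_kermxP.
pose y i := if i \in A then u 0 (enum_rank_in Ai0 i) else 0.
have yE k : y (enum_val k) = u 0 k.
  by rewrite /y enum_valP enum_valK_in.
exists y; split.
- have /rV0Pn [k uk] := u0.
  by exists (enum_val k); rewrite yE.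
- by move=> i /negbTE iA; rewrite /y iA.
- move=> j Bj.
  have := congr1 (fun N : 'rV_ _ => N 0 (enum_rank_in Bj j)) uM.
  rewrite !mxE => uMj; rewrite -[RHS]uMj {uMj}.
  rewrite (bigID (mem A)) /= [X in _ + X]big1 ?addr0; last first.
    by move=> i /negbTE iA; rewrite /y iA mul0r.
  rewrite big_enum_val /=; apply: eq_bigr => k _.
  by rewrite yE !mxE enum_rankK_in.
Qed.

End Move.


(** * Gluing perfect matchings at a tight cut *)

Section Cuts.
Local Open Scope ring_scope.
Variable E : finType.
Implicit Types (x y c : E -> rat) (M : {set E}).

(** Edmonds' description of the perfect matching polytope, with weight zero on the loops that
    contraction creates. *)
Definition fractional_pm (V : finType) (ends : E -> V * V) x :=
  [/\ forall f, 0 <= x f,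
      forall f, (ends f).1 = (ends f).2 -> x f = 0,
      forall v, \sum_(f | bd ends [set v] f) x f = 1 &
      forall X : {set V}, odd #|X| -> 1 <= \sum_(f | bd ends X f) x f].

(** By separation of convex sets this says that [x] lies in the convex hull of the perfect matchings
    contained in its support. *)
Definition pm_dominates (V : finType) (ends : E -> V * V) x :=
  forall c, exists M, [/\ forall f, f \in M -> 0 < x f,
    forall v, #|[set f in M | bd ends [set v] f]| = 1%N &
    \sum_f c f * x f <= \sum_(f in M) c f].

Section Contraction.
Variables (V : finType) (ends : E -> V * V) (x : E -> rat).
Implicit Types (X Z : {set V}).

(** [None] is the vertex to which [Z] shrinks. *)
Definition contr (Z : {set V}) (v : V) : option {v | v \notin Z} := insub v.
Definition cends Z f := (contr Z (ends f).1, contr Z (ends f).2).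

Lemma contr_bd Z (Y : {set option {v | v \notin Z}}) f : bd (cends Z) Y f = bd ends (contr Z @^-1: Y) f.
Proof. by rewrite /bd !inE. Qed.

Lemma contr_None Z v : (contr Z v == None) = (v \in Z).
Proof. by rewrite /contr; case: insubP => [u /negbTE -> _|/negbNE ->]. Qed.

Lemma contr_in Z v : v \in Z -> contr Z v = None.
Proof. by rewrite -contr_None => /eqP. Qed.

Lemma preim_None Z : contr Z @^-1: [set None] = Z.
Proof. by apply/setP => v; rewrite !inE contr_None. Qed.

Lemma preim_Some Z (u : {v | v \notin Z}) : contr Z @^-1: [set Some u] = [set val u].
Proof.
apply/setP => v; rewrite !inE /contr; case: insubP => [w wZ <-|/negbNE vZ].
  by rewrite (inj_eq Some_inj) (inj_eq val_inj).
by apply/esym/negbTE/eqP => vu; move: (valP u); rewrite -vu vZ.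
Qed.

(** If [Y] contains the contracted vertex, its preimage trades this one vertex for the odd number
    [#|Z|]. *)
Lemma odd_preim Z (Y : {set option {v | v \notin Z}}) : odd #|Z| -> odd #|contr Z @^-1: Y| = odd #|Y|.
Proof.
move=> oZ.
have cardP (W : {set option {v | v \notin Z}}) : None \notin W -> #|contr Z @^-1: W| = #|W|.
  move=> nW; rewrite -sum1_card (partition_big (contr Z) (mem W)) /=; last first.
    by move=> v; rewrite inE.
  rewrite -[RHS]sum1_card; apply: eq_bigr => -[u|] uW; last by rewrite uW in nW.
  rewrite sum1_card -[RHS](cards1 (val u)) -preim_Some.
  apply: eq_card => v; rewrite !inE unfold_in /= inE.
  by case: eqP => [->|_]; rewrite ?andbF ?uW.
case: (boolP (None \in Y)) => nY; last by rewrite cardP.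
rewrite -(setD1K nY) preimsetU preim_None.
have d1 : None \notin Y :\ None by rewrite !inE eqxx.
rewrite cardsU1 d1 cardsU cardP //.
suff -> : Z :&: contr Z @^-1: (Y :\ None) = set0.
  by rewrite cards0 subn0 oddD oZ.
by apply/setP => v; rewrite !inE; case: (boolP (v \in Z)) => // /contr_in ->.
Qed.

Lemma card_contr (Z : {set V}) : #|{: option {v | v \notin Z}}| = #|~: Z|.+1.
Proof.
by rewrite card_option card_sig; congr _.+1; apply: eq_card => v; rewrite !inE.
Qed.

Definition cwt (Z : {set V}) f : rat := if ins ends Z f then 0 else x f.

Lemma bd_preim_ins Z (Y : {set option {v | v \notin Z}}) f : bd ends (contr Z @^-1: Y) f -> ins ends Z f = false.
Proof.
apply: contraTF => /andP[pZ qZ].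
by rewrite /bd !inE (contr_in pZ) (contr_in qZ) addbb.
Qed.

Lemma sum_cwt Z (Y : {set option {v | v \notin Z}}) :
  \sum_(f | bd (cends Z) Y f) cwt Z f = \sum_(f | bd ends (contr Z @^-1: Y) f) x f.
Proof.
rewrite (eq_bigl _ _ (contr_bd Y)); apply: eq_bigr => f bf.
by rewrite /cwt (bd_preim_ins bf).
Qed.

Lemma fractional_pm_contr Z : fractional_pm ends x -> odd #|Z| ->
  \sum_(f | bd ends Z f) x f = 1 -> fractional_pm (cends Z) (cwt Z).
Proof.
case=> x0 xl xv xodd oZ tZ; split.
- by move=> f; rewrite /cwt; case: ifP.
- move=> f /= e; rewrite /cwt; case: ifP => // /negP nZ.
  apply: xl; move: e; rewrite /contr.
  case: insubP => [u _ <-|/negbNE pZ]; case: insubP => [w _ <-|/negbNE qZ] //.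
    by case=> ->.
  by case: nZ; rewrite /ins pZ qZ.
- move=> [u|]; rewrite sum_cwt; first by rewrite preim_Some.
  by rewrite preim_None.
- by move=> Y oY; rewrite sum_cwt; apply: xodd; rewrite odd_preim.
Qed.

(** A perfect matching of the graph with [Z] contracted, in the support of [x], but expressed on the
    original vertices so that both sides of a cut can be put together. *)
Definition valid (Z : {set V}) (M : {set E}) : bool :=
  [&& [forall f in M, (0 < x f) && ~~ ins ends Z f],
      [forall v, (v \notin Z) ==> (#|[set f in M | bd ends [set v] f]| == 1%N)] &
      #|[set f in M | bd ends Z f]| == 1%N].

Definition contr_dominates Z := forall c, exists2 M, valid Z M &
  \sum_(f | ~~ ins ends Z f) c f * x f <= \sum_(f in M) c f.

Lemma pm_dominates_contr Z : pm_dominates (cends Z) (cwt Z) -> contr_dominates Z.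
Proof.
move=> H c; have [M [M0 Mv Mc]] := H c.
have insM f : f \in M -> 0 < x f /\ ~~ ins ends Z f.
  by move=> /M0; rewrite /cwt; case: ifP; rewrite ?ltxx.
exists M.
  apply/and3P; split.
  - by apply/forall_inP => f /insM [-> ->].
  - apply/forallP => v; apply/implyP => vZ.
    rewrite -(Mv (Some (Sub v vZ))); apply/eqP/eq_card => f.
    by rewrite !inE contr_bd preim_Some SubK.
  - rewrite -(Mv None); apply/eqP/eq_card => f.
    by rewrite !inE contr_bd preim_None.
apply: le_trans Mc; rewrite big_mkcond /= le_eqVlt; apply/orP; left; apply/eqP.
by apply: eq_bigr => f _; rewrite /cwt; case: (ins _ _ _) => /=; rewrite ?mulr0.
Qed.

Lemma sum_split (X : {set V}) (P : pred E) (F : E -> rat) :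
  \sum_(f | P f) F f = \sum_(f | P f && ins ends X f) F f +
     \sum_(f | P f && ins ends (~: X) f) F f + \sum_(f | P f && bd ends X f) F f.
Proof.
rewrite (bigID (ins ends X)) /= -addrA; congr (_ + _).
rewrite (bigID (ins ends (~: X))) /=.
congr (_ + _); apply: eq_bigl => f; rewrite /ins /bd !inE;
  by case: (P f); do 2 case: (_ \in X).
Qed.

Lemma sum_split_ins (X : {set V}) (F : E -> rat) :
  \sum_(f | ~~ ins ends (~: X) f) F f =
  \sum_(f | ins ends X f) F f + \sum_(f | bd ends X f) F f.
Proof.
rewrite (bigID (ins ends X)) /=; congr (_ + _); apply: eq_bigl => f;
  rewrite /ins /bd !inE; by do 2 case: (_ \in X).
Qed.

Lemma valid_cut Z M : valid Z M -> exists f, [/\ f \in M, bd ends Z f &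
   forall g, g \in M -> bd ends Z g -> g = f].
Proof.
case/and3P => _ _ /cards1P [f fE].
have : f \in [set f in M | bd ends Z f] by rewrite fE inE.
rewrite inE => /andP[fM bf]; exists f; split=> // g gM bg.
by apply/set1P; rewrite -fE inE gM bg.
Qed.

Lemma valid_sum X M (F : E -> rat) f : valid (~: X) M -> f \in M -> bd ends X f ->
  \sum_(g in M) F g = \sum_(g in M | ins ends X g) F g + F f.
Proof.
move=> vM fM bf.
have [f' [f'M bf' uf]] := valid_cut vM.
have ff' : f = f' by apply: uf => //; rewrite bdC.
rewrite (sum_split X) [X in _ + X + _]big1 ?addr0; last first.
  move=> g /andP[gM]; case/and3P: vM => /forall_inP /(_ g gM) /andP[_ /negbTE H] _ _.
  by rewrite H.
congr (_ + _); rewrite (big_pred1 f) // => g /=.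
apply/andP/eqP => [[gM bg]|->]; last by [].
by rewrite ff'; apply: uf; rewrite ?bdC.
Qed.

(* Gluing at a tight cut: the cut edges of one side are charged with the best
   cost [h] of a completion on the other side, so that no decomposition into a
   convex combination is needed. *)
Lemma glue X : contr_dominates X -> contr_dominates (~: X) -> pm_dominates ends x.
Proof.
move=> HX HX' c.
pose cin M := \sum_(g in M | ins ends X g) c g.
have H f : exists M1, bd ends X f -> 0 < x f -> [/\ valid (~: X) M1, f \in M1 &
    forall M', valid (~: X) M' -> f \in M' -> cin M' <= cin M1].
  case: (boolP (bd ends X f && (0 < x f))) => [/andP[bf xf]|]; last first.
    by move/negP => nb; exists set0 => b1 b2; case: nb; rewrite b1 b2.
  (* The cost that singles out [f] has fractional value [x f > 0], so a matching that does as well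
     must contain [f]. *)
  have [M0 vM0 cM0] := HX' (fun g => (g == f)%:R).
  have fM0 : f \in M0.
    apply: contraTT cM0 => fM0; rewrite -ltNge [ltLHS]big1; last first.
      by move=> g gM; case: eqP gM => // ->; rewrite (negbTE fM0).
    rewrite (bigD1 f) /=; last by rewrite /ins !inE; move: bf; rewrite /bd; do 2 case: (_ \in X).
    rewrite eqxx mul1r big1 ?addr0 // => g /andP[_ /negbTE ->]; exact: mul0r.
  have P0 : valid (~: X) M0 && (f \in M0) by rewrite vM0.
  case: (@Order.TotalTheory.arg_maxP _ _ {set E} M0
     (fun M => valid (~: X) M && (f \in M)) cin P0) => M1 /andP[v1 f1] m1.
  by exists M1 => _ _; split=> // M' v' f'; apply: m1; rewrite v' f'.
have [m mP] := choice H.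
pose h f := cin (m f).
(* With cost [- h] on the cut, every valid matching costs at most zero by the maximality that
   defines [h]; domination passes this sign on to [x]. *)
have hle : \sum_(f | ins ends X f) c f * x f <= \sum_(f | bd ends X f) h f * x f.
  have [M1 v1 c1] := HX' (fun f => if bd ends X f then - h f else c f).
  have [f1 [f1M bf1 _]] := valid_cut v1.
  rewrite bdC in bf1.
  move: c1; rewrite (valid_sum _ v1 f1M bf1) bf1 sum_split_ins.
  rewrite (eq_bigr (fun f => c f * x f)); last by move=> f /[dup] iX; case: ifP => // /bd_ins ->.
  rewrite [X in _ + X](eq_bigr (fun f => - (h f * x f))); last by move=> f ->; rewrite mulNr.
  rewrite sumrN.
  rewrite [X in _ <= X - _](eq_bigr c); last by move=> f /andP[_] /[dup] iX; case: ifP => // /bd_ins ->.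
  have xf1 : 0 < x f1 by case/and3P: v1 => /forall_inP /(_ _ f1M) /andP[].
  have [_ _ /(_ _ v1 f1M)] := mP f1 bf1 xf1.
  rewrite -/(h f1) /cin; lra.
(* On this side a cut edge earns its own cost plus that of its best completion; the completion
   [m f2] of the cut edge actually used then pays the promised [h f2]. *)
have [M2 v2 c2] := HX (fun f => if bd ends X f then c f + h f else c f).
have v2' : valid (~: ~: X) M2 by rewrite setCK.
have [f2 [f2M bf2 uf2]] := valid_cut v2.
have xf2 : 0 < x f2 by case/and3P: v2 => /forall_inP /(_ _ f2M) /andP[].
have [v1 f2M1 _] := mP f2 bf2 xf2.
have [f1 [f1M bf1 uf1]] := valid_cut v1.
have e12 : f2 = f1 by apply: uf1; rewrite ?bdC.
move: uf1; rewrite -{}e12 {f1 f1M bf1} => uf1.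
set M1 := m f2 in v1 f2M1 uf1 *.
have ins1 g : g \in M1 -> ~~ ins ends (~: X) g.
  by case/and3P: v1 => /forall_inP H1 _ _ /H1 /andP[].
have ins2 g : g \in M2 -> ~~ ins ends X g.
  by case/and3P: v2 => /forall_inP H1 _ _ /H1 /andP[].
have at1 v g : v \in X -> bd ends [set v] g -> (g \in M1 :|: M2) = (g \in M1).
  move=> vX bg; rewrite inE; case: (boolP (g \in M2)) => gM2; last by rewrite orbF.
  suff -> : g = f2 by rewrite f2M1.
  apply: uf2 => //; move: (ins2 _ gM2) bg; rewrite /ins /bd !inE.
  by do 2 (case: eqP => [->|_]; rewrite ?vX //); do 2 case: (_ \in X).
have at2 v g : v \notin X -> bd ends [set v] g -> (g \in M1 :|: M2) = (g \in M2).
  move=> vX bg; rewrite inE; case: (boolP (g \in M1)) => gM1 //.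
  suff -> : g = f2 by rewrite f2M.
  apply: uf1 => //; move: (ins1 _ gM1) bg; rewrite /ins bdC /bd !inE.
  by do 2 (case: eqP => [->|_]; rewrite ?(negbTE vX) //); do 2 case: (_ \in X).
exists (M1 :|: M2); split.
- move=> f; rewrite inE => /orP[fM1|fM2].
    by case/and3P: v1 => /forall_inP /(_ _ fM1) /andP[].
  by case/and3P: v2 => /forall_inP /(_ _ fM2) /andP[].
- move=> v; case: (boolP (v \in X)) => vX.
    case/and3P: v1 => _ /forallP /(_ v); rewrite inE negbK vX => /eqP <- _.
    apply: eq_card => g; rewrite !inE.
    by case: (boolP (bd ends [set v] g)) => bg; rewrite ?andbF //; have := at1 v g vX bg; rewrite inE => ->.
  case/and3P: v2 => _ /forallP /(_ v); rewrite vX => /eqP <- _.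
  apply: eq_card => g; rewrite !inE.
  by case: (boolP (bd ends [set v] g)) => bg; rewrite ?andbF //; have := at2 v g vX bg; rewrite inE => ->.
- have -> : \sum_(f in M1 :|: M2) c f = cin M1 + (\sum_(g in M2 | ins ends (~: X) g) c g + c f2).
    rewrite (sum_split X) -addrA; congr (_ + (_ + _)).
    + apply: eq_bigl => g; rewrite inE; case: (boolP (ins ends X g)) => ig; rewrite ?andbF // !andbT.
      by case: (boolP (g \in M2)) => [/ins2|]; rewrite ?ig ?orbF.
    + apply: eq_bigl => g; rewrite inE; case: (boolP (ins ends (~: X) g)) => ig; rewrite ?andbF // !andbT.
      by case: (boolP (g \in M1)) => [/ins1|]; rewrite ?ig.
    + rewrite (big_pred1 f2) // => g /=; rewrite inE.
      apply/andP/eqP => [[/orP[gM bg|gM bg]]|->]; last by rewrite f2M orbT.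
        by apply: uf1; rewrite ?bdC.
      exact: uf2.
  have E1 : \sum_(f | ~~ ins ends X f) (if bd ends X f then c f + h f else c f) * x f =
      \sum_(f | ins ends (~: X) f) c f * x f +
      (\sum_(f | bd ends X f) c f * x f + \sum_(f | bd ends X f) h f * x f).
    rewrite -{1}[X]setCK sum_split_ins -big_split /=; congr (_ + _).
      by apply: eq_bigr => f iX; rewrite -bdC; case: ifP => // /bd_ins; rewrite iX.
    by apply: eq_big => f; rewrite bdC // => ->; rewrite mulrDl.
  have E2 : \sum_(f in M2) (if bd ends X f then c f + h f else c f) =
      \sum_(g in M2 | ins ends (~: X) g) c g + (c f2 + h f2).
    rewrite (valid_sum _ v2' f2M) ?bdC // bf2; congr (_ + _).
    by apply: eq_bigr => f /andP[_ iX]; rewrite -bdC; case: ifP => // /bd_ins; rewrite iX.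
  rewrite [\sum_f c f * x f](sum_split X predT) /=.
  move: c2 hle; rewrite E1 E2 {2}/h -/M1; lra.
Qed.

End Contraction.
End Cuts.


(** * Fractional edges: perturbation directions and tight odd cuts *)

Section FractionalEdges.
Local Open Scope ring_scope.
Variable E : finType.
Implicit Types (x y c : E -> rat) (M : {set E}).

Section Weighting.
Variables (V : finType) (ends : E -> V * V) (x : E -> rat).
Hypothesis xP : fractional_pm ends x.
Implicit Types (X Z : {set V}).

Lemma other_end v f : bd ends [set v] f ->
  exists2 a, a != v & forall Z, bd ends Z f = (v \in Z) (+) (a \in Z).
Proof.
rewrite /bd !inE; case: (eqVneq (ends f).1 v) => [<-|n1] /=.
  by move=> n2; exists (ends f).2.
by move/eqP=> e2; exists (ends f).1 => // Z; rewrite addbC e2.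
Qed.

Lemma wt_ge0 f : 0 <= x f. Proof. by case: xP. Qed.

Lemma wt_le1 v f : bd ends [set v] f -> x f <= 1.
Proof.
case: xP => x0 _ xv _ bf; rewrite -(xv v) (bigD1 f) //= lerDl.
by apply: sumr_ge0 => g _; apply: x0.
Qed.

(** The whole vertex set has an empty boundary, so it would violate its own constraint if it were
    odd. *)
Lemma order_even : odd #|V| = false.
Proof.
case: xP => _ _ _ xo; apply/negP => oV; have := xo setT; rewrite cardsT => /(_ oV).
rewrite big1; first by [].
by move=> f; rewrite /bd !inE.
Qed.

Lemma oddC X : odd #|~: X| = odd #|X|.
Proof. by have := order_even; rewrite -(cardsC X) oddD; do 2 case: (odd _). Qed.

Definition frac : {set E} := [set f | (0 < x f) && (x f < 1)].
Definition fracV : {set V} := [set v | [exists f in frac, bd ends [set v] f]].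

Lemma frac_other v g : v \in fracV -> bd ends [set v] g -> g \notin frac -> x g = 0.
Proof.
rewrite inE => /exists_inP [f fF bf] bg gF.
apply/eqP; rewrite eq_le wt_ge0 andbT leNgt; apply/negP => xg.
have xg1 : 1 <= x g by rewrite leNgt; apply: contra gF => xg1; rewrite inE xg xg1.
case: xP => x0 _ xv _; move: (xv v).
have gf : g != f by apply: contraNneq gF => ->.
rewrite (bigD1 f) //= (bigD1 g) /=; last by rewrite bg gf.
have : 0 <= \sum_(i | bd ends [set v] i && (i != f) && (i != g)) x i.
  by apply: sumr_ge0 => i _; apply: x0.
move: fF; rewrite inE => /andP[]; lra.
Qed.

Lemma frac_sum v : v \in fracV -> \sum_(f in frac | bd ends [set v] f) x f = 1.
Proof.
move=> vF; case: xP => _ _ /(_ v) <- _.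
rewrite [RHS](bigID (mem frac)) /= [X in _ + X]big1 ?addr0.
  by apply: eq_bigl => f; rewrite andbC.
by move=> f /andP[bf fF]; apply: frac_other vF bf fF.
Qed.

Definition fdeg v := #|[set f in frac | bd ends [set v] f]|.

Lemma fdeg_ge2 v : v \in fracV -> (2 <= fdeg v)%N.
Proof.
move=> vF; have s1 := frac_sum vF; move: vF; rewrite inE => /exists_inP [f fF bf].
move: s1; rewrite (bigD1 f) /=; last by rewrite fF bf.
move=> s1; rewrite /fdeg (cardsD1 f) [f \in _]in_set fF bf /= ltnS card_gt0.
apply: contraPneq s1 => e0; rewrite big1.
  by rewrite addr0 => x1; move: fF; rewrite in_set x1 ltxx andbF.
move=> g /andP[/andP[gF bg] gf]; have : g \in set0 by rewrite -e0 in_setD1 gf in_set gF bg.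
by rewrite inE.
Qed.

Lemma frac_end f : f \in frac ->
  ((ends f).1 \in fracV) && ((ends f).2 \in fracV).
Proof.
move=> fF; have n12 : (ends f).1 != (ends f).2.
  apply/negP => /eqP e; case: xP => _ /(_ f e) xf _ _.
  by move: fF; rewrite inE xf ltxx.
rewrite !inE; apply/andP; split; apply/exists_inP; exists f => //;
  by rewrite /bd !inE eqxx ?(negbTE n12) // eq_sym (negbTE n12).
Qed.

Lemma sum_fdeg : (\sum_(v in fracV) fdeg v = 2 * #|frac|)%N.
Proof.
rewrite (eq_bigr (fun v => \sum_(f in frac) bd ends [set v] f)%N); last first.
  move=> v _; rewrite /fdeg -sum1_card big_mkcond [RHS]big_mkcond /=.
  by apply: eq_bigr => f _; rewrite inE; case: (f \in frac); case: (bd _ _ _).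
rewrite exchange_big /= -sum1_card big_distrr /=; apply: eq_bigr => f fF.
have /andP[p q] := frac_end fF.
rewrite star_card ?p ?q //.
apply/negP => /eqP e; case: xP => _ /(_ f e) xf _ _.
by move: fF; rewrite inE xf ltxx.
Qed.

Definition direction y := [/\ exists f, y f != 0, forall f, f \notin frac -> y f = 0 &
  forall v, \sum_(f | bd ends [set v] f) y f = 0].

Lemma direction_out y v : (forall f, f \notin frac -> y f = 0) -> v \notin fracV ->
  \sum_(f | bd ends [set v] f) y f = 0.
Proof.
move=> yF vF; apply: big1 => f bf; apply: yF; apply: contra vF => fF.
by rewrite inE; apply/exists_inP; exists f.
Qed.

Lemma direction_dim : (#|fracV| < #|frac|)%N -> exists y, direction y.
Proof.
move=> /(kernel_vector (fun f v => (bd ends [set v] f)%:R)) [y [y1 y2 y3]].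
exists y; split=> // v; case: (boolP (v \in fracV)) => vF; last exact: direction_out.
rewrite -[RHS](y3 v vF) big_mkcond; apply: eq_bigr => f _.
by case: (bd _ _ _); rewrite ?mulr1 ?mulr0.
Qed.

(** The fractional degrees are at least two and sum to [2 * #|frac|], so none can exceed two. *)
Lemma fdeg_eq2 : (#|frac| <= #|fracV|)%N -> forall v, v \in fracV -> fdeg v = 2%N.
Proof.
move=> le v vF; have s := sum_fdeg.
apply/eqP; rewrite eqn_leq fdeg_ge2 // andbT.
move: s; rewrite (bigD1 v) //=.
have : (2 * #|fracV :\ v| <= \sum_(i in fracV | i != v) fdeg i)%N.
  rewrite -sum1_card big_distrr /= (eq_bigl (fun i => (i \in fracV) && (i != v))); last first.
    by move=> i; rewrite !inE andbC.
  by apply: leq_sum => i /andP[iF _]; rewrite muln1; apply: fdeg_ge2.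
move: le; rewrite (cardsD1 v fracV) vF; lia.
Qed.

(** All fractional degrees are two here, so [2 * x f - 1] sums to [2 - 2] at a fractional vertex: it
    is a direction unless it vanishes on all fractional edges. *)
Lemma direction_half : (#|frac| <= #|fracV|)%N ->
  (exists y, direction y) \/ forall f, f \in frac -> x f = 2^-1.
Proof.
move=> le.
pose y f := if f \in frac then 2 * x f - 1 else 0.
have yF f : f \notin frac -> y f = 0 by rewrite /y => /negbTE ->.
case: (pselect (exists f, y f != 0)) => [y1|y0].
  left; exists y; split=> // v; case: (boolP (v \in fracV)) => vF; last exact: direction_out.
  rewrite (bigID (mem frac)) /= [X in _ + X]big1 ?addr0; last by move=> f /andP[_ /yF].
  rewrite (eq_bigl (fun f => (f \in frac) && bd ends [set v] f)); last by move=> f; rewrite andbC.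
  rewrite (eq_bigr (fun f => 2 * x f - 1)); last by move=> f /andP[fF _]; rewrite /y fF.
  rewrite sumrB -mulr_sumr frac_sum // sumr_const.
  rewrite (_ : #|_| = 2%N) ?mulr1 ?subrr //.
  by rewrite -(fdeg_eq2 le vF) /fdeg; apply: eq_card => f; rewrite [RHS]in_set.
right=> f fF; have : y f = 0 by apply/eqP/negPn/negP => yf; apply: y0; exists f.
rewrite /y fF; lra.
Qed.

(** On four vertices the star equations give opposite pairs equal weight. As [v a] and [v b] weigh
    at least 1/2 each, they weigh exactly 1/2, and [v w] weighs nothing. Keeping [x] on the pairs
    [v a] and [b w] and negating it on the others is then zero-sum. *)
Lemma direction_four v a b w : (#|frac| <= #|fracV|)%N ->
  uniq [:: v; a; b; w] -> (forall z, z \in [:: v; a; b; w]) ->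
  v \in fracV -> a \in fracV -> b \in fracV ->
  (exists2 f, x f = 2^-1 & forall Z, bd ends Z f = (v \in Z) (+) (a \in Z)) ->
  (exists2 g, x g = 2^-1 & forall Z, bd ends Z g = (v \in Z) (+) (b \in Z)) ->
  exists y, direction y.
Proof.
move=> le /= + cov vF aF bF [f0 xf0 bf0] [g0 xg0 bg0].
rewrite !inE !negb_or -!andbA => /and4P[va vb vw /and4P[ab aw bw _]].
pose J s t h := bd ends [set s] h && bd ends [set t] h.
pose e s t := \sum_h x h * (J s t h)%:R.
pose y h := x h * (1 - 2 * (bd ends [set v; a] h)%:R).
have [x0 xl xv _] := xP.
have J0 s t : 0 <= e s t by apply: sumr_ge0 => h _; rewrite mulr_ge0.
have evafull : 2^-1 <= e v a.
  rewrite /e (bigD1 f0) //= xf0 /J !bf0 !inE !eqxx (negbTE va) (eq_sym a) (negbTE va) mulr1 lerDl.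
  by apply: sumr_ge0 => h _; rewrite mulr_ge0.
have evbfull : 2^-1 <= e v b.
  rewrite /e (bigD1 g0) //= xg0 /J !bg0 !inE !eqxx (negbTE vb) (eq_sym b) (negbTE vb) mulr1 lerDl.
  by apply: sumr_ge0 => h _; rewrite mulr_ge0.
have endsP h : [\/ (ends h).1 = v, (ends h).1 = a, (ends h).1 = b | (ends h).1 = w] /\
   [\/ (ends h).2 = v, (ends h).2 = a, (ends h).2 = b | (ends h).2 = w].
  split; [move: (cov (ends h).1)|move: (cov (ends h).2)]; rewrite !inE => /or4P[] /eqP ->;
   by [constructor 1|constructor 2|constructor 3|constructor 4].
have sym := (eq_sym a v, eq_sym b v, eq_sym w v, eq_sym b a, eq_sym w a, eq_sym w b).
have neqs := (negbTE va, negbTE vb, negbTE vw, negbTE ab, negbTE aw, negbTE bw).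
have X1 : 1 = e v a + e v b + e v w.
  rewrite -(xv v) big_mkcond /e -!big_split /=; apply: eq_bigr => h _; rewrite /J /bd !inE.
  case: (endsP h) => [[] ep [] eq]; rewrite ep eq !(eqxx, sym, neqs) /=; ring.
have X2 : 1 = e v a + e a b + e a w.
  rewrite -(xv a) big_mkcond /e -!big_split /=; apply: eq_bigr => h _; rewrite /J /bd !inE.
  case: (endsP h) => [[] ep [] eq]; rewrite ep eq !(eqxx, sym, neqs) /=; ring.
have X3 : 1 = e v b + e a b + e b w.
  rewrite -(xv b) big_mkcond /e -!big_split /=; apply: eq_bigr => h _; rewrite /J /bd !inE.
  case: (endsP h) => [[] ep [] eq]; rewrite ep eq !(eqxx, sym, neqs) /=; ring.
have X4 : 1 = e v w + e a w + e b w.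
  rewrite -(xv w) big_mkcond /e -!big_split /=; apply: eq_bigr => h _; rewrite /J /bd !inE.
  case: (endsP h) => [[] ep [] eq]; rewrite ep eq !(eqxx, sym, neqs) /=; ring.
have Y1 : \sum_(h | bd ends [set v] h) y h = e v a - e v b - e v w.
  rewrite big_mkcond /e -!sumrB /=; apply: eq_bigr => h _; rewrite /y /J /bd !inE.
  case: (endsP h) => [[] ep [] eq]; rewrite ep eq !(eqxx, sym, neqs) /=; ring.
have Y2 : \sum_(h | bd ends [set a] h) y h = e v a - e a b - e a w.
  rewrite big_mkcond /e -!sumrB /=; apply: eq_bigr => h _; rewrite /y /J /bd !inE.
  case: (endsP h) => [[] ep [] eq]; rewrite ep eq !(eqxx, sym, neqs) /=; ring.
have Y3 : \sum_(h | bd ends [set b] h) y h = e b w - e v b - e a b.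
  rewrite big_mkcond /e -!sumrB /=; apply: eq_bigr => h _; rewrite /y /J /bd !inE.
  case: (endsP h) => [[] ep [] eq]; rewrite ep eq !(eqxx, sym, neqs) /=; ring.
have Y4 : \sum_(h | bd ends [set w] h) y h = e b w - e v w - e a w.
  rewrite big_mkcond /e -!sumrB /=; apply: eq_bigr => h _; rewrite /y /J /bd !inE.
  case: (endsP h) => [[] ep [] eq]; rewrite ep eq !(eqxx, sym, neqs) /=; ring.
have := J0 v w; have := J0 a b; move=> e1 e2.
exists y; split.
- by exists f0; rewrite /y bf0 !inE !eqxx orbT /= xf0.
- move=> h hF; rewrite /y; suff -> : x h = 0 by rewrite mul0r.
  case: (endsP h) => [[] ep [] eq]; try (by apply: xl; rewrite ep eq);
  first [ by apply: (frac_other vF _ hF); rewrite /bd !inE ep eq !(eqxx, sym, neqs)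
        | by apply: (frac_other aF _ hF); rewrite /bd !inE ep eq !(eqxx, sym, neqs)
        | by apply: (frac_other bF _ hF); rewrite /bd !inE ep eq !(eqxx, sym, neqs) ].
- move=> z; move: (cov z); rewrite !inE => /or4P[] /eqP ->; rewrite ?Y1 ?Y2 ?Y3 ?Y4; lra.
Qed.

(** The three stars have total weight three, and [f] and [g] have both ends inside and so use up two
    of it. At most one is left for the boundary. *)
Lemma path_tight v a b f g : v != a -> v != b -> a != b ->
  x f = 2^-1 -> x g = 2^-1 ->
  (forall Z, bd ends Z f = (v \in Z) (+) (a \in Z)) ->
  (forall Z, bd ends Z g = (v \in Z) (+) (b \in Z)) ->
  odd #|[set v; a; b]| /\ \sum_(h | bd ends [set v; a; b] h) x h = 1.
Proof.
move=> va vb ab xf xg bf bg.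
have c3 : #|[set v; a; b]| = 3%N.
  by rewrite -setUA cardsU1 cards2 !inE negb_or va vb ab.
rewrite c3; split=> //; have [x0 xl xv xo] := xP.
apply/eqP; rewrite eq_le xo ?c3 // andbT.
have fg : g != f.
  apply: contraTneq isT => gf; move: (bf [set a]) (bg [set a]).
  by rewrite gf => -> ; rewrite !inE eqxx (negbTE va) (eq_sym b) (negbTE ab).
have bdf : bd ends [set v; a; b] f = false by rewrite bf !inE !eqxx orbT.
have bdg : bd ends [set v; a; b] g = false by rewrite bg !inE !eqxx orbT.
have ends_in h u t : (forall Z, bd ends Z h = (u \in Z) (+) (t \in Z)) -> u != t ->
    u \in [set v; a; b] -> t \in [set v; a; b] ->
    ((ends h).1 \in [set v; a; b]) && ((ends h).2 \in [set v; a; b]).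
  move=> bh ut uX tX.
  suff [[-> ->]|[-> ->]] : ((ends h).1 = u /\ (ends h).2 = t) \/ ((ends h).1 = t /\ (ends h).2 = u).
  - by rewrite uX tX.
  - by rewrite uX tX.
  have := bh [set u]; have := bh [set t].
  rewrite /bd !in_set1 !eqxx (negbTE ut) (eq_sym t) (negbTE ut) /=.
  case: (eqVneq (ends h).1 t) => [->|_]; case: (eqVneq (ends h).2 t) => [->|_] //= _.
    by rewrite (eq_sym t) (negbTE ut) /= => /eqP ->; right.
  by rewrite (eq_sym t) (negbTE ut) addbF => /eqP ->; left.
have inf := ends_in f v a bf va; have ing := ends_in g v b bg vb.
have {inf} /andP[f1 f2] : ((ends f).1 \in [set v; a; b]) && ((ends f).2 \in [set v; a; b]).
  by apply: inf; rewrite !inE eqxx ?orbT.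
have {ing} /andP[g1 g2] : ((ends g).1 \in [set v; a; b]) && ((ends g).2 \in [set v; a; b]).
  by apply: ing; rewrite !inE eqxx ?orbT.
have := star_sum [set v; a; b] xl.
rewrite (eq_bigr (fun=> 1)) // sumr_const c3 => s3.
move: s3; rewrite (bigD1 f) //= (bigD1 g) //= f1 f2 g1 g2 xf xg.
have -> : \sum_(h | bd ends [set v; a; b] h) x h =
    \sum_(i | (i != f) && (i != g)) (if bd ends [set v; a; b] i then x i else 0).
  by rewrite big_mkcond (bigD1 f) //= (bigD1 g) //= bdf bdg !add0r.
have : \sum_(i | (i != f) && (i != g)) (if bd ends [set v; a; b] i then x i else 0) <=
  \sum_(i | (i != f) && (i != g)) x i * (((ends i).1 \in [set v; a; b])%:R + ((ends i).2 \in [set v; a; b])%:R).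
  apply: ler_sum => i _; rewrite /bd; have := x0 i.
  by case: (_ \in _); case: (_ \in _) => /=; lra.
rewrite /= !mulr1n; lra.
Qed.

Lemma direction_or_tight : frac != set0 -> (exists y, direction y) \/
  exists X, [/\ odd #|X|, \sum_(f | bd ends X f) x f = 1, (1 < #|X|)%N & (1 < #|~: X|)%N].
Proof.
case/set0Pn => f0 f0F.
case: (ltnP #|fracV| #|frac|) => [/direction_dim d|le]; first by left.
have [d|half] := direction_half le; first by left.
have /andP[vF _] := frac_end f0F; set v := (ends f0).1 in vF.
have /cards2P [f [g [fg fgE]]] : #|[set f in frac | bd ends [set v] f]| == 2%N.
  by rewrite -/(fdeg v) fdeg_eq2.
have /andP[fF bf] : (f \in frac) && bd ends [set v] f.
  have : f \in [set f; g] by rewrite set21.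
  by rewrite -fgE in_set.
have /andP[gF bg] : (g \in frac) && bd ends [set v] g.
  have : g \in [set f; g] by rewrite set22.
  by rewrite -fgE in_set.
have [a av ba] := other_end bf; have [b bv bb] := other_end bg.
case: (eqVneq a b) => [ab|ab].
  left; exists (fun h => (h == f)%:R - (h == g)%:R); split.
  - by exists f; rewrite eqxx (negbTE fg) subr0 oner_eq0.
  - move=> h hF; case: eqP hF => [->|_]; rewrite ?fF //.
    by case: eqP => [->|_]; rewrite ?gF ?subr0.
  - have gf : g != f by rewrite eq_sym.
    move=> z; rewrite big_mkcond /= (bigD1 f) //= (bigD1 g gf) /= big1.
      by rewrite ba bb ab !eqxx (negbTE fg) (negbTE gf); case: (_ (+) _); rewrite ?subr0 ?sub0r ?addr0 ?subrr.
    by move=> h /andP[/negbTE -> /negbTE ->]; rewrite subr0 if_same.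
rewrite eq_sym in av; rewrite eq_sym in bv.
have [oX tX] := path_tight av bv ab (half _ fF) (half _ gF) ba bb.
(* The complement of the triple is odd too: if it has at most one vertex, it has exactly one, and
   the graph has four vertices. *)
case: (ltnP 1 #|~: [set v; a; b]|) => cC.
  right; exists [set v; a; b]; split=> //.
  by move: oX; rewrite -setUA cardsU1 cards2 !inE negb_or av bv ab.
left; have /cards1P [w wE] : #|~: [set v; a; b]| == 1%N.
  by move: cC; rewrite -oddC in oX; case: #|_| oX => [|[|]].
have wX : w \notin [set v; a; b].
  have : w \in ~: [set v; a; b] by rewrite wE set11.
  by rewrite in_setC.
move: wX; rewrite !inE !negb_or -andbA => /and3P[wv wa wb].
apply: (@direction_four v a b w) => //.
- by rewrite /= !inE !negb_or av bv ab (eq_sym v) wv (eq_sym a) wa (eq_sym b) wb.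
- move=> z; rewrite !inE; case: (boolP (z \in [set v; a; b])).
    by rewrite !inE => /orP[/orP[]|] ->; rewrite ?orbT.
  move=> zX; have : z \in ~: [set v; a; b] by rewrite in_setC.
  by rewrite wE in_set1 => ->; rewrite !orbT.
- by rewrite inE; apply/exists_inP; exists f => //; rewrite ba !inE eqxx (negbTE av).
- by rewrite inE; apply/exists_inP; exists g => //; rewrite bb !inE eqxx (negbTE bv).
- by exists f => //; apply: half.
- by exists g => //; apply: half.
Qed.

End Weighting.
End FractionalEdges.


(** * Edmonds' perfect matching polytope *)

Section Polytope.
Local Open Scope ring_scope.
Variable E : finType.
Implicit Types (x y c : E -> rat) (M : {set E}).

Lemma integral_dominates (V : finType) (ends : E -> V * V) x :
  fractional_pm ends x -> frac x = set0 -> pm_dominates ends x.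
Proof.
move=> xP F0 c; have [x0 xl xv _] := xP.
pose M := [set f | 0 < x f].
have x1 f v : bd ends [set v] f -> f \in M -> x f = 1.
  move=> bf; rewrite inE => xf; apply/eqP; rewrite eq_le (wt_le1 xP bf) /= leNgt.
  apply/negP => xf1; have : f \in set0 by rewrite -F0 inE xf xf1.
  by rewrite inE.
have nM f : f \notin M -> x f = 0.
  by rewrite inE -leNgt => xf; apply/eqP; rewrite eq_le xf x0.
exists M; split.
- by move=> f; rewrite inE.
- move=> v; apply/eqP; rewrite -(eqr_nat rat) -sum1_card natr_sum -[eqbRHS]mulr1n -[X in _ == X *+ 1](xv v) mulr1n.
  rewrite [eqbRHS](bigID (mem M)) /= [X in _ == _ + X]big1 ?addr0; last by move=> f /andP[_ /nM].
  apply/eqP; apply: eq_big => [f|f]; first by rewrite inE andbC.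
  by rewrite in_set => /andP[fM bf]; rewrite (x1 _ _ bf fM).
- rewrite (bigID (mem M)) /= [X in _ + X]big1 ?addr0; last by move=> f /nM ->; rewrite mulr0.
  rewrite le_eqVlt; apply/orP; left; apply/eqP; apply: eq_bigr => f fM.
  have bf : bd ends [set (ends f).1] f.
    rewrite /bd !inE eqxx /=; apply: contraTneq fM => e; rewrite inE xl ?ltxx //.
  by rewrite (x1 _ _ bf fM) mulr1.
Qed.

(** Contracting one shore leaves the other plus one vertex, which is a smaller graph because both
    shores have at least two vertices. *)
Lemma tight_dominates (V : finType) (ends : E -> V * V) x (X : {set V}) :
  (forall (W : finType) (e : E -> W * W) z, (#|W| < #|V|)%N ->
     fractional_pm e z -> pm_dominates e z) ->
  fractional_pm ends x -> odd #|X| -> \sum_(f | bd ends X f) x f = 1 ->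
  (1 < #|X|)%N -> (1 < #|~: X|)%N -> pm_dominates ends x.
Proof.
move=> IH xP oX tX cX cX'; have cV := cardsC X.
apply: (@glue _ _ _ _ X); apply: pm_dominates_contr; apply: IH.
- by rewrite card_contr; lia.
- exact: fractional_pm_contr.
- by rewrite card_contr setCK; lia.
- apply: fractional_pm_contr => //; first by rewrite (oddC xP).
  by rewrite -tX; apply: eq_bigl => f; rewrite bdC.
Qed.

(** The outer induction, on the order, serves contraction; the inner one, on the support, serves
    perturbation. A point that has a direction is moved along one that does not lower [c], until an
    edge weight vanishes or a nontrivial odd cut becomes tight. *)
Theorem edmonds (V : finType) (ends : E -> V * V) x :
  fractional_pm ends x -> pm_dominates ends x.
Proof.
have [n] := ubnP #|V|; elim: n V ends x => // n IHV V ends x.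
rewrite ltnS => cV.
have IH (W : finType) (e : E -> W * W) z : (#|W| < #|V|)%N ->
    fractional_pm e z -> pm_dominates e z.
  by move=> WV; apply: IHV; apply: leq_trans cV.
have [k] := ubnP #|[set f | 0 < x f]|; elim: k x => // k IHk x.
rewrite ltnS => ck xP.
case: (eqVneq (frac x) set0) => [|/(direction_or_tight xP)]; first exact: integral_dominates.
case=> [|[X [oX tX cX cX']]]; last exact: (tight_dominates IH xP oX tX).
move=> [y0 dy0] c.
have [y [[f0 yf0] yF yv] cy] : exists2 y, direction ends x y & 0 <= \sum_f c f * y f.
  case: (lerP 0 (\sum_f c f * y0 f)) => cy; first by exists y0.
  case: dy0 => [[f yf] yF yv]; exists (fun f => - y0 f).
    split; first by exists f; rewrite oppr_eq0.
      by move=> g /yF ->; rewrite oppr0.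
    by move=> v; rewrite sumrN yv oppr0.
  by rewrite (eq_bigr (fun f => - (c f * y0 f))) ?sumrN ?oppr_ge0 ?ltW // => g _; rewrite mulrN.
have [x0 xl xv xo] := xP.
(* Stars, and complements of vertices, keep boundary sum one along a zero-sum direction. The value
   zero of [a] and [b] at other sets keeps them from ever blocking the move. *)
pose nontriv (X : {set V}) := [&& odd #|X|, (1 < #|X|)%N & (1 < #|~: X|)%N].
pose a (i : E + {set V}) := match i with inl f => x f
  | inr X => if nontriv X then \sum_(f | bd ends X f) x f - 1 else 0 end.
pose b (i : E + {set V}) := match i with inl f => y f
  | inr X => if nontriv X then \sum_(f | bd ends X f) y f else 0 end.
have a0 i : 0 <= a i.
  case: i => [f|X] //=; case: ifP => // /and3P[oX _ _]; by rewrite subr_ge0 xo.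
have [f1 yf1] : exists f, y f < 0.
  have f0F : f0 \in frac x by apply: contraNT yf0 => /yF ->.
  have bf0 : bd ends [set (ends f0).1] f0.
    rewrite /bd !inE eqxx /=; apply: contraTneq f0F => e.
    by rewrite inE xl ?ltxx.
  case: (ltgtP (y f0) 0) => yf; first by exists f0.
    have := yv (ends f0).1; rewrite (bigD1 f0) //= => s0.
    apply/not_existsP => H; move: s0; apply/eqP; rewrite gt_eqF //.
    apply: ltr_wpDr => //; apply: sumr_ge0 => f _; rewrite leNgt; apply/negP; exact: H.
  by rewrite yf eqxx in yf0.
have [s [s0 sa [i bi si]]] := move_to_boundary a0 (ex_intro _ (inl f1) yf1 : exists i, b i < 0).
pose x' f := x f + s * y f.
have x'sum X : \sum_(f | bd ends X f) x' f =
    \sum_(f | bd ends X f) x f + s * \sum_(f | bd ends X f) y f.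
  by rewrite big_split /= mulr_sumr.
have x'v v : \sum_(f | bd ends [set v] f) x' f = 1 by rewrite x'sum xv yv mulr0 addr0.
have x'P : fractional_pm ends x'.
  split=> //.
  - by move=> f; have := sa (inl f).
  - move=> f e; rewrite /x' (xl _ e) yF ?mulr0 ?addr0 //.
    by rewrite inE (xl _ e) ltxx.
  - move=> X oX; case: (leqP #|X| 1) => cX.
      have /cards1P [v ->] : #|X| == 1%N by case: #|X| oX cX => [|[]].
      by rewrite x'v.
    have oX' : odd #|~: X| by rewrite (oddC xP).
    case: (leqP #|~: X| 1) => cX'.
      have /cards1P [v vE] : #|~: X| == 1%N by case: #|~: X| oX' cX' => [|[]].
      by rewrite (eq_bigl (bd ends [set v])) ?x'v // => f; rewrite -vE bdC.
    have := sa (inr X); rewrite /= /nontriv oX cX cX' /= x'sum; lra.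
have supp f : 0 < x' f -> 0 < x f.
  rewrite [0 < x f]lt_neqAle x0 andbT /x' => x'f; apply: contraTneq x'f => xf.
  by rewrite -xf yF ?mulr0 ?addr0 ?ltxx // inE -xf ltxx.
have cx' : \sum_f c f * x f <= \sum_f c f * x' f.
  rewrite [leRHS](eq_bigr (fun f => c f * x f + s * (c f * y f))) => [|f _]; last by rewrite /x'; ring.
  by rewrite big_split /= -mulr_sumr lerDl mulr_ge0.
suff [M [M0 Mv Mc]] : exists M, [/\ forall f, f \in M -> 0 < x' f,
    forall v, #|[set f in M | bd ends [set v] f]| = 1%N &
    \sum_f c f * x' f <= \sum_(f in M) c f].
  by exists M; split=> // [f /M0 /supp //|]; apply: le_trans Mc.
case: i bi si => [f|X] /= bi si.
  apply: IHk => //; apply: leq_trans ck; apply: proper_card; apply/properP; split.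
    by apply/subsetP => g; rewrite !inE; apply: supp.
  have fF : f \in frac x by apply: contraTT bi => /yF ->; rewrite ltxx.
  exists f; rewrite inE; first by move: fF; rewrite inE => /andP[].
  by rewrite /x' si ltxx.
case: (boolP (nontriv X)) bi si => [/and3P[oX cX cX']|]; last by rewrite ltxx.
move=> _ si; apply: (tight_dominates IH x'P oX _ cX cX').
rewrite x'sum; lra.
Qed.

End Polytope.


(** * Zero-sum vectors along closed walks of even length *)

Section LinearMax.
Local Open Scope ring_scope.
Variables (E : finType) (L : (E -> rat) -> Prop) (g : E).
Hypothesis L0 : L (fun=> 0).
Hypothesis Llin : forall s y d, L y -> L d -> L (fun f => y f + s * d f).
Implicit Types (y d : E -> rat).

Definition boxed y := forall f, -1 <= y f <= 1.
Definition tight y : {set E * bool} := [set p | y p.1 == (if p.2 then 1 else -1)].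
(** The linear algebra form of a vertex of the polytope that the cube cuts out of [L]. *)
Definition vertex y := [/\ L y, boxed y &
  forall d, L d -> (forall p, p \in tight y -> d p.1 = 0) -> forall f, d f = 0].

(** A point that is no vertex admits a nonzero direction fixing its tight coordinates. Oriented so
    as not to lower the coordinate [g], it is followed to a wall of the cube, where a new coordinate
    becomes tight. *)
Lemma boxed_vertex y : L y -> boxed y -> exists2 z, vertex z & y g <= z g.
Proof.
have [n] := ubnP #|~: tight y|; elim: n y => // n IH y; rewrite ltnS => cn Ly by1.
case: (pselect (vertex y)) => [vy|nvy]; first by exists y.
have [d0 [Ld0 dt0 [f0 df0]]] : exists d, [/\ L d, forall p, p \in tight y -> d p.1 = 0 &
    exists f, d f <> 0].
  apply: contrapT => H; apply: nvy; split=> // d Ld dt f.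
  by apply: contrapT => df; apply: H; exists d; split=> //; exists f.
have [d [Ld dt df dg]] : exists d, [/\ L d, forall p, p \in tight y -> d p.1 = 0,
    d f0 != 0 & 0 <= d g].
  case: (lerP 0 (d0 g)) => dg; first by exists d0; split=> //; apply/eqP.
  exists (fun f => 0 + -1 * d0 f); split; first exact: Llin.
  - by move=> p /dt0 ->; rewrite mulr0 addr0.
  - by rewrite add0r mulN1r oppr_eq0; apply/eqP.
  - by rewrite add0r mulN1r oppr_ge0 ltW.
pose a (p : E * bool) := if p.2 then 1 - y p.1 else 1 + y p.1.
pose b (p : E * bool) := if p.2 then - d p.1 else d p.1.
have a0 p : 0 <= a p by rewrite /a; have /andP[] := by1 p.1; case: p.2; lra.
have bneg : exists p, b p < 0.
  case: (ltgtP (d f0) 0) => df'; first by exists (f0, false).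
    by exists (f0, true); rewrite /b /= oppr_lt0.
  by rewrite df' eqxx in df.
have [s [s0 sa [p bp sp]]] := move_to_boundary a0 bneg.
pose y' f := y f + s * d f.
have by' : boxed y'.
  by move=> f; have := sa (f, true); have := sa (f, false); rewrite /a /b /y' /=; lra.
have Ly' : L y' by exact: Llin.
have [|z vz zg] := IH y' _ Ly' by'.
  apply: leq_trans cn; apply: proper_card; apply/properP; split.
    rewrite setCS; apply/subsetP => q qt; have := dt q qt.
    by move: qt; rewrite !inE /y' => /eqP -> ->; rewrite mulr0 addr0.
  exists p; rewrite in_setC ?negbK.
    by apply/negP => /dt dp; move: bp; rewrite /b dp oppr0 if_same ltxx.
  rewrite inE /y'; move: sp; rewrite /a /b; case: p.2 => sp; apply/eqP; lra.
exists z => //; apply: le_trans zg; by rewrite /y' lerDl mulr_ge0.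
Qed.

Lemma vertex_tight y z : vertex y -> vertex z -> tight y = tight z -> forall f, y f = z f.
Proof.
move=> [Ly _ uy] [Lz _ _] yz f; apply/eqP; rewrite -subr_eq0; apply/eqP.
have -> : y f - z f = y f + -1 * z f by rewrite mulN1r.
apply: (uy (fun f => y f + -1 * z f)); first exact: Llin.
move=> p pt; have := pt; rewrite {1}yz; move: pt.
by rewrite !inE => /eqP -> /eqP ->; rewrite mulN1r subrr.
Qed.

(** Over the rationals a maximum cannot come from compactness. Instead, every point lies below a
    vertex, a vertex is determined by its tight set, and there are finitely many such sets. *)
Lemma boxed_max : exists y, [/\ L y, boxed y & forall z, L z -> boxed z -> z g <= y g].
Proof.
have H (T : {set E * bool}) : exists y, (exists2 z, vertex z & tight z = T) ->
    vertex y /\ tight y = T.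
  case: (pselect (exists2 z, vertex z & tight z = T)) => [[z vz zT]|nz].
    by exists z.
  by exists (fun=> 0) => z; case: nz.
have [Y YP] := choice H.
have [|z0 vz0 _] := @boxed_vertex (fun=> 0) L0.
  by move=> f; rewrite lerN10 ler01.
have YE z : vertex z -> vertex (Y (tight z)) /\ z g = Y (tight z) g.
  move=> vz; have [vY tY] := YP (tight z) (ex_intro2 _ _ z vz erefl).
  by split=> //; apply: vertex_tight.
have P0 : `[< vertex (Y (tight z0)) >] by apply/asboolP; have [] := YE _ vz0.
case: (@Order.TotalTheory.arg_maxP _ _ {set E * bool} (tight z0)
  (fun T => `[< vertex (Y T) >]) (fun T => Y T g) P0) => T /asboolP vT mT.
exists (Y T); split; try by case: vT.
move=> z Lz bz; have [w vw zw] := boxed_vertex Lz bz.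
apply: le_trans zw _; have [vY ->] := YE _ vw.
by apply: mT; apply/asboolP.
Qed.

End LinearMax.

Section EvenCycle.
Local Open Scope ring_scope.
Variables (V E : finType) (ends : E -> V * V).
Hypothesis noloop : forall f, (ends f).1 != (ends f).2.
Implicit Types (U W A : {set V}) (S : {set E}) (y d : E -> rat).

Definition zero_sum S y := (forall f, f \notin S -> y f = 0) /\
  forall v, \sum_(f | bd ends [set v] f) y f = 0.

(** This is 2-edge-connectedness of the graph [(U, S)]; cut vertices are allowed. *)
Definition two_connected U S :=
  (forall f, f \in S -> ins ends U f) /\
  forall W, W \subset U -> W != set0 -> W != U ->
    (2 <= #|[set f in S | bd ends W f]|)%N.

(** Formulated through boundaries to be independent of the orientation stored in [ends]. *)
Definition joined f a b := a != b /\ forall Z, bd ends Z f = (a \in Z) (+) (b \in Z).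

Lemma joined_ends f : joined f (ends f).1 (ends f).2.
Proof. by split. Qed.

Lemma joinedC f a b : joined f a b -> joined f b a.
Proof. by case=> ab H; split=> [|Z]; rewrite 1?eq_sym // addbC. Qed.

Lemma joinedP f a b : joined f a b ->
  ((ends f).1 = a /\ (ends f).2 = b) \/ ((ends f).1 = b /\ (ends f).2 = a).
Proof.
case=> ab bf; have := bf [set a]; have := bf [set b].
rewrite /bd !in_set1 !eqxx (negbTE ab) (eq_sym b) (negbTE ab) /=.
case: (eqVneq (ends f).1 b) => [->|_]; case: (eqVneq (ends f).2 b) => [->|_] //= _.
  by rewrite (eq_sym b) (negbTE ab) /= => /eqP ->; right.
by rewrite (eq_sym b) (negbTE ab) addbF => /eqP ->; left.
Qed.

Lemma joined_star f a b v (k : rat) : joined f a b ->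
  \sum_(h | bd ends [set v] h) (if h == f then k else 0) = k * ((v == a)%:R + (v == b)%:R).
Proof.
case=> ab H; rewrite big_mkcond (bigD1 f) //= big1 ?addr0; last first.
  by move=> h /negbTE ->; rewrite if_same.
rewrite eqxx H !inE (eq_sym v a) (eq_sym v b).
case: (eqVneq a v) ab => [->|_]; case: (eqVneq b v) => //= *; rewrite ?eqxx //; lra.
Qed.

Section Residual.
Variables (U : {set V}) (S : {set E}) (g : E) (y : E -> rat).
Hypothesis US : two_connected U S.
Hypothesis gS : g \in S.
Hypothesis ys : zero_sum S y.
Hypothesis yb : boxed y.
Hypothesis ymax : forall z, zero_sum S z -> boxed z -> z g <= y g.
Hypothesis yg : y g < 1.

Definition residual d := [/\ forall f, f \notin S -> d f = 0,
  forall f, 0 < d f -> y f < 1 & forall f, d f < 0 -> -1 < y f].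

Lemma residualD d d' : residual d -> residual d' -> residual (fun f => d f + d' f).
Proof.
move=> [s1 p1 n1] [s2 p2 n2]; split=> f.
- by move=> fS; rewrite s1 // s2 // addr0.
- case: (ltP 0 (d f)) => [/p1 //|df]; case: (ltP 0 (d' f)) => [/p2 //|d'f]; lra.
- case: (ltP (d f) 0) => [/n1 //|df]; case: (ltP (d' f) 0) => [/n2 //|d'f]; lra.
Qed.

Lemma no_augmentation d : residual d -> 0 < d g ->
  ~ (forall v, \sum_(f | bd ends [set v] f) d f = 0).
Proof.
move=> [ds dp dn] dg dv.
pose a (p : E * bool) := if p.2 then 1 - y p.1 else 1 + y p.1.
pose b (p : E * bool) := if p.2 then - d p.1 else d p.1.
have a0 p : 0 <= a p by rewrite /a; have /andP[] := yb p.1; case: p.2; lra.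
have bneg : exists p, b p < 0 by exists (g, true); rewrite /b /= oppr_lt0.
have [s [s0 sa [p bp sp]]] := move_to_boundary a0 bneg.
have sgt : 0 < s.
  rewrite lt_neqAle s0 andbT eq_sym; apply: contraPneq sp => ->; rewrite mul0r addr0.
  move: bp; rewrite /a /b; case: p.2 => bp.
    have := dp p.1; rewrite -oppr_lt0 => /(_ bp); lra.
  by have := dn p.1 bp; lra.
suff : y g + s * d g <= y g by rewrite leNgt ltrDl mulr_gt0.
apply: (ymax (z := fun f => y f + s * d f)).
- case: ys => y1 y2; split=> [f fS|v]; first by rewrite y1 // ds // mulr0 addr0.
  by rewrite big_split /= -mulr_sumr y2 dv mulr0 addr0.
- by move=> f; have := sa (f, true); have := sa (f, false); rewrite /a /b /=; lra.
Qed.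

(** An alternating walk from [u] to [z] that avoids [g], remembered only by its star sums. An edge
    adds the same value at both ends, so steps must alternate in sign; the first lowers the star of
    [u], and [sg] is true after an even number of steps. *)
Definition reach u z (sg : bool) := exists2 d, residual d & d g = 0 /\
  forall v, \sum_(f | bd ends [set v] f) d f =
    (if sg then 1 else -1) * (v == z)%:R - (v == u)%:R.

Lemma reach0 u : reach u u true.
Proof.
exists (fun=> 0); first by split=> f //; rewrite ltxx.
by split=> // v; rewrite big1 // mul1r subrr.
Qed.

Lemma reach_step u a z f sg : f \in S -> f != g -> joined f a z ->
  (if sg then -1 < y f else y f < 1) -> reach u a sg -> reach u z (~~ sg).
Proof.
move=> fS fg J yf [d rd [dg dv]].
pose k : rat := if sg then -1 else 1.
exists (fun h => d h + (if h == f then k else 0)).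
  apply: residualD => //; split=> h; case: eqP => [->|_]; rewrite ?ltxx ?fS //.
    by rewrite /k; case: sg yf {dv k} => //; rewrite oppr_gt0 ltr10.
  by rewrite /k; case: sg yf {dv k} => //; rewrite ltr10.
split; first by rewrite dg eq_sym (negbTE fg) addr0.
move=> v; rewrite big_split /= dv (joined_star v k J) /k; case: sg {dv yf k} => /=; lra.
Qed.

(** Walks of both parities combine to an odd closed walk, of star sum -2 at [u]. *)
Lemma reach_back u z : reach u z true -> reach u z false -> reach u u false.
Proof.
move=> [d rd [dg dv]] [d' rd' [dg' dv']].
exists (fun f => d f + d' f); first exact: residualD.
split; first by rewrite dg dg' addr0.
by move=> v; rewrite big_split /= dv dv'; lra.
Qed.

Lemma residual_g : residual (fun h => if h == g then 1 else 0).
Proof. by split=> h; case: eqP => [->|_]; rewrite ?gS ?ltxx ?ltr10. Qed.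

Lemma reach_other u v : joined g u v -> ~ reach u v false.
Proof.
move=> J [d rd [dg dv]].
apply: (no_augmentation (residualD rd residual_g)); first by rewrite dg eqxx add0r.
by move=> w; rewrite big_split /= dv (joined_star w 1 J); lra.
Qed.

(** Odd closed walks at both ends of [g], together with [g] taken twice, have star sums zero and
    would raise [y g]. *)
Lemma reach_both u v : joined g u v -> reach u u false -> ~ reach v v false.
Proof.
move=> J [d rd [dg dv]] [d' rd' [dg' dv']].
apply: (no_augmentation (residualD (residualD rd rd') (residualD residual_g residual_g))).
  by rewrite dg dg' eqxx; lra.
by move=> w; rewrite !big_split /= dv dv' (joined_star w 1 J); lra.
Qed.

(** Complementary slackness. Vertices reached with sign true or false get potential 1 or -1, and
    [pi] adds the potentials of the two ends. An edge other than [g] with [pi] nonzero is saturated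
    against it, so the star equations force [y g * pi g] to equal the total of [|pi f|]. As
    [y g < 1], this total is too small for [A :|: B] to be a proper subset of [U] or for a further
    edge to lie within one class. *)
Lemma reach_bipartite u v : joined g u v -> ~ reach u u false ->
  exists A, forall f, f \in S -> bd ends A f = (f != g).
Proof.
move=> J nuu.
pose A := [set z | `[< reach u z true >]]; pose B := [set z | `[< reach u z false >]].
have uA : u \in A by rewrite inE; apply/asboolP; apply: reach0.
have vB : v \notin B by rewrite inE; apply/asboolP; apply: reach_other.
have AB z : z \in A -> z \notin B.
  rewrite !inE => /asboolP zA; apply/asboolP => zB; apply: nuu; exact: reach_back zA zB.
have stepA f a z : f \in S -> f != g -> joined f a z -> a \in A -> z \notin B -> y f = -1.
  move=> fS fg Jf; rewrite !inE => /asboolP aA /asboolP zB.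
  apply/eqP; rewrite eq_le leNgt; have /andP[-> _] := yb f; rewrite andbT.
  by apply/negP => yf; apply: zB; exact: (reach_step (sg := true) fS fg Jf yf aA).
have stepB f a z : f \in S -> f != g -> joined f a z -> a \in B -> z \notin A -> y f = 1.
  move=> fS fg Jf; rewrite !inE => /asboolP aA /asboolP zB.
  apply/eqP; rewrite eq_le [_ <= y f]leNgt; have /andP[_ ->] := yb f.
  by apply/negP => yf; apply: zB; exact: (reach_step (sg := false) fS fg Jf yf aA).
have AU z : z \in A :|: B -> z \in U.
  rewrite inE; case: (boolP (z \in U)) => // zU H; exfalso.
  have zu : z == u = false.
    apply: contraNF zU => /eqP ->; have [/(_ g gS) /andP[i1 i2] _] := US.
    by case: (joinedP J) => -[e1 e2]; rewrite -?e1 // -e2.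
  have noS (d : E -> rat) : (forall f, f \notin S -> d f = 0) -> \sum_(f | bd ends [set z] f) d f = 0.
    move=> ds; apply: big1 => f bf; apply: ds; apply: contra zU => fS.
    have [/(_ f fS) /andP[i1 i2] _] := US; move: bf; rewrite /bd !inE.
    by case: eqP => [<-|_] //=; case: eqP => [<-|].
  by case/orP: H; rewrite inE => /asboolP [d [ds _ _] [_ /(_ z)]];
    rewrite noS // eqxx zu subr0 mulr1; lra.
pose pi f : rat := ((ends f).1 \in A)%:R + ((ends f).2 \in A)%:R
   - ((ends f).1 \in B)%:R - ((ends f).2 \in B)%:R.
have sum0 : \sum_f y f * pi f = 0.
  have loop0 f : (ends f).1 = (ends f).2 -> y f = 0.
    by move=> e; have := noloop f; rewrite e eqxx.
  rewrite (eq_bigr (fun f => y f * (((ends f).1 \in A)%:R + ((ends f).2 \in A)%:R)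
     - y f * (((ends f).1 \in B)%:R + ((ends f).2 \in B)%:R))); last by move=> f _; rewrite /pi; ring.
  rewrite sumrB -!star_sum // !big1 ?subr0 // => w _; by case: ys.
have ypi f : f \in S -> f != g -> y f * pi f = - `|pi f|.
  move=> fS fg; have J1 := joined_ends f; have J2 := joinedC J1.
  have := stepA f _ _ fS fg J1; have := stepA f _ _ fS fg J2.
  have := stepB f _ _ fS fg J1; have := stepB f _ _ fS fg J2.
  have := AB (ends f).1; have := AB (ends f).2; rewrite /pi.
  case: (_ \in A); case: (_ \in A) => /=; case: (_ \in B); case: (_ \in B) => //= p1 p2 s1 s2 s3 s4;
    first [ by have := p1 isT | by have := p2 isT
          | rewrite (s1 isT isT) | rewrite (s2 isT isT) | rewrite (s3 isT isT) | rewrite (s4 isT isT) | idtac ];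
    first [ rewrite ger0_norm; lra | rewrite ler0_norm; lra ].
pose T : rat := \sum_(f in S | f != g) `|pi f|.
have yT : y g * pi g = T.
  move: sum0; rewrite (bigID (mem S)) /= [X in _ + X]big1 ?addr0; last first.
    by move=> f fS; case: ys => -> //; rewrite mul0r.
  rewrite (bigD1 g) //= (eq_bigr (fun f => - `|pi f|)); last by move=> f /andP[]; exact: ypi.
  by rewrite sumrN -/T => /eqP; rewrite subr_eq0 => /eqP.
have pig : pi g = 1 + (v \in A)%:R.
  rewrite /pi; have uB := AB u uA.
  by case: (joinedP J) => -[-> ->]; rewrite uA (negbTE uB) (negbTE vB); case: (v \in A) => /=; lra.
have Tlt : T < 1 + (v \in A)%:R.
  by rewrite -yT pig -[ltRHS]mul1r ltr_pM2r // ltr_wpDr ?ler0n.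
pose W := A :|: B.
have WU : W \subset U by apply/subsetP => z; exact: AU.
have W0 : W != set0 by apply/set0Pn; exists u; rewrite inE uA.
have cross f : bd ends W f -> `|pi f| = 1.
  rewrite /bd /pi !in_setU.
  have := AB (ends f).1; have := AB (ends f).2.
  case: (_ \in A); case: (_ \in A) => /=; case: (_ \in B); case: (_ \in B) => //= p1 p2;
    first [ by have := p1 isT | by have := p2 isT
          | by rewrite ?subr0 ?addr0 ?add0r ?sub0r ?normrN ?normr1 ].
have cW : (#|[set f in S | (f != g) && bd ends W f]|)%:R <= T.
  rewrite -sum1_card natr_sum /T [leRHS](bigID (bd ends W)) /=.
  rewrite -[leLHS]addr0; apply: lerD; last by apply: sumr_ge0.
  rewrite le_eqVlt; apply/orP; left; apply/eqP; apply: eq_big => f.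
    by rewrite inE andbA.
  by rewrite inE => /and3P[_ _ /cross ->].
have cS : (#|[set f in S | bd ends W f]| <= bd ends W g + #|[set f in S | (f != g) && bd ends W f]|)%N.
  rewrite (cardsD1 g) !inE gS /= leq_add2l; apply: subset_leq_card.
  by apply/subsetP => f; rewrite !inE => /and3P[-> -> ->].
have gW : bd ends W g = (v \notin A).
  have [_ ->] := J; rewrite !inE.
  by move: uA vB; rewrite !inE => -> /negbTE ->; rewrite orbF.
(* [g] leaves [W] exactly when [v] is not in [A]; so a proper [W] would have at least
   [1 + (v \in A)] other boundary edges, each contributing one to [T]. *)
have WE : W = U.
  apply/eqP; apply/negPn/negP => WnU; have [_ /(_ W WU W0 WnU) c2] := US.
  have c3 := leq_trans c2 cS; rewrite gW in c3.
  have : (1 + (v \in A) <= #|[set f in S | (f != g) && bd ends W f]|)%N.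
    by move: c3; case: (v \in A).
  rewrite -(ler_nat rat) natrD => c4.
  by move: (le_lt_trans (le_trans c4 cW) Tlt); rewrite ltxx.
have vA : v \in A.
  have : v \in W.
    rewrite WE; have [/(_ g gS) /andP[i1 i2] _] := US.
    by case: (joinedP J) => -[e1 e2]; rewrite -?e1 // -e2.
  by rewrite inE (negbTE vB) orbF.
exists A => f fS; case: (eqVneq f g) => [->|fg].
  by have [_ ->] := J; rewrite uA vA.
have [/(_ f fS) /andP[]] := US; rewrite -WE !in_setU => i1 i2 _.
have Tf : `|pi f| < 2.
  move: Tlt; rewrite vA /T (bigD1 f) /=; last by rewrite fS fg.
  have : 0 <= \sum_(i | (i \in S) && (i != g) && (i != f)) `|pi i| by apply: sumr_ge0.
  lra.
move: Tf i1 i2; rewrite /pi /bd.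
have := AB (ends f).1; have := AB (ends f).2.
case: (_ \in A); case: (_ \in A) => /=; case: (_ \in B); case: (_ \in B) => //= p1 p2;
  first [by have := p1 isT | by have := p2 isT | idtac];
  first [rewrite ger0_norm; lra | rewrite ler0_norm; lra].
Qed.

End Residual.

(** The second alternative is a true exception: the two ends of [g] lie in the same class of an
    otherwise bipartite graph, and the alternating sum of the star equations forces [y g = 0]. The
    search for walks starts at an end of [g] without an odd closed walk. *)
Lemma even_walk U S g : two_connected U S -> g \in S ->
  (exists y, [/\ zero_sum S y, boxed y & y g = 1]) \/
  (exists A, forall f, f \in S -> bd ends A f = (f != g)).
Proof.
move=> US gS.
have [||y [ys yb ymax]] := @boxed_max E (zero_sum S) g.
- by split=> // v; rewrite big1.
- move=> s y d [y1 y2] [d1 d2]; split=> [f fS|v]; first by rewrite y1 // d1 // mulr0 addr0.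
  by rewrite big_split /= -mulr_sumr y2 d2 mulr0 addr0.
case: (ltP (y g) 1) => yg; last first.
  by left; exists y; split=> //; apply/eqP; rewrite eq_le yg andbT; case/andP: (yb g).
right; have J := joined_ends g.
case: (pselect (reach S g y (ends g).1 (ends g).1 false)) => [r1|]; last first.
  by apply: (reach_bipartite US gS ys yb ymax yg J).
apply: (reach_bipartite US gS ys yb ymax yg (joinedC J)) => r2.
exact: (reach_both gS ys yb ymax yg J r1 r2).
Qed.

(** In the exceptional case the vertices on which the two colourings disagree would be cut off by
    [g] alone. *)
Lemma even_walk_bipartite U S g C : two_connected U S -> g \in S ->
  (forall f, f \in S -> bd ends C f) ->
  exists y, [/\ zero_sum S y, boxed y & y g = 1].
Proof.
move=> US gS SC; have [//|[A SA]] := even_walk US gS; exfalso.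
pose Z := [set z in U | (z \in A) (+) (z \in C)].
have bZ f : f \in S -> bd ends Z f = (f == g).
  move=> fS; have [/(_ f fS) /andP[i1 i2] _] := US.
  move: (SC f fS) (SA f fS); rewrite /bd !inE i1 i2 /=.
  by case: (f == g); do 4 case: (_ \in _).
have gZ : bd ends Z g by rewrite bZ ?eqxx.
have /US.2 : Z \subset U by apply/subsetP => z; rewrite inE => /andP[].
move=> /(_ _ _) H; have {}H : (2 <= #|[set f in S | bd ends Z f]|)%N.
  apply: H.
    by apply: contraTneq gZ => ->; rewrite /bd !inE.
  apply: contraTneq gZ => ->; have [/(_ g gS) /andP[i1 i2] _] := US.
  by rewrite /bd i1 i2.
suff : (#|[set f in S | bd ends Z f]| <= #|[set g]|)%N by rewrite cards1 leqNgt H.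
apply: subset_leq_card; apply/subsetP => f; rewrite !inE => /andP[fS].
by rewrite bZ.
Qed.
End EvenCycle.


(** * Gadgets *)

Section Gadgets.
Variables (V E : finType) (ends : E -> V * V).
Hypothesis noloop : forall f, (ends f).1 != (ends f).2.
Hypothesis cub : forall v, #|[set f | bd ends [set v] f]| = 3.
Implicit Types (U W T A C Z : {set V}) (S X : {set E}).

(** Normalised to the unit cube; the factor 2/15 is applied when gadgets are superposed. *)
Definition gadget U := exists w, forall f, bd ends [set w] f ->
  exists y : E -> rat, [/\ forall h, ~~ ins ends U h -> y h = 0%R,
    forall v, (\sum_(h | bd ends [set v] h) y h = 0)%R, boxed y & y f = (-1)%R].

Definition inside S U := [set f in S | ins ends U f].

Lemma ins_sub U W f : W \subset U -> ins ends W f -> ins ends U f.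
Proof. by move=> /subsetP WU /andP[/WU p /WU q]; apply/andP. Qed.

Lemma inside_split S U W : W \subset U ->
  #|inside S U| = #|inside S W| + #|inside S (U :\: W)| +
    #|[set f in inside S U | bd ends W f]|.
Proof.
move=> /subsetP WU.
rewrite -[LHS](cardsID [set f | ins ends W f]) -addnA; congr (_ + _).
  apply: eq_card => f; rewrite !inE; case: (f \in S) => //=.
  by apply/andP/idP => [[]//|iW]; split=> //; apply: ins_sub iW; apply/subsetP.
rewrite -[LHS](cardsID [set f | ins ends (U :\: W) f]); congr (_ + _).
  apply: eq_card => f; rewrite !inE /ins !inE.
  by case: (f \in S); do 2 case: (_ \in W); do 2 case: (_ \in U).
apply: eq_card => f; rewrite !inE /ins /bd !inE.
by case: (f \in S) => //=; do 2 case: (_ \in W); do 2 case: (_ \in U).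
Qed.

Lemma sum_deg_inside S U : \sum_(v in U) #|[set f in inside S U | bd ends [set v] f]| =
  2 * #|inside S U|.
Proof.
rewrite (eq_bigr (fun v => \sum_(f in inside S U) bd ends [set v] f)); last first.
  move=> v _; rewrite -sum1_card big_mkcond [RHS]big_mkcond /=.
  by apply: eq_bigr => f _; rewrite in_set; case: (f \in _); case: (bd _ _ _).
rewrite exchange_big /= -sum1_card big_distrr /=; apply: eq_bigr => f.
by rewrite in_set => /andP[_ /andP[p q]]; rewrite star_card // p q.
Qed.

(** The average degree inside [U] exceeds two, while no degree exceeds three. *)
Lemma full_vertex S U : #|U| < #|inside S U| ->
  exists2 w, w \in U & forall f, bd ends [set w] f -> f \in inside S U.
Proof.
move=> cU; apply: contrapT => H.
suff : 2 * #|inside S U| <= 2 * #|U| by lia.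
rewrite -sum_deg_inside -[#|U|]sum1_card big_distrr /= muln1.
apply: leq_sum => v vU; rewrite -ltnS -(cub v) ltnNge; apply/negP => c3.
apply: H; exists v => // f bf.
have /eqP e : [set f in inside S U | bd ends [set v] f] == [set f | bd ends [set v] f].
  rewrite eqEcard c3 andbT; apply/subsetP => h; rewrite !inE => /andP[_ ->] //.
have : f \in [set f | bd ends [set v] f] by rewrite inE.
by rewrite -e in_set => /andP[].
Qed.

Lemma gadget_intro U S U0 : U \subset U0 -> two_connected ends U (inside S U) ->
  #|U| < #|inside S U| ->
  (forall f, f \in inside S U ->
     exists y, [/\ zero_sum ends (inside S U) y, boxed y & y f = 1%R]) -> gadget U0.
Proof.
move=> UU0 [US _] /full_vertex [w wU wS] H; exists w => f /wS /H [y [[y0 ys] yb yf]].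
exists (fun h => - y h)%R; split.
- move=> h hU; rewrite y0 ?oppr0 //; apply: contra hU => /US; exact: ins_sub.
- by move=> v; rewrite sumrN ys oppr0.
- by move=> h; have /andP[y1 y2] := yb h; rewrite lerN2 y2 lerNl y1.
- by rewrite yf.
Qed.

Lemma minimal_set (P : pred {set V}) U0 : P U0 -> exists U, [/\ U \subset U0, P U &
  forall W, W \subset U -> P W -> W = U].
Proof.
move=> P0; have [U /minsetP [PU mU] UU0] := minset_exists P0.
by exists U; split=> // W WU PW; apply: mU.
Qed.

(** The successor makes sparsity additive across a cut with at most one edge: two sparse parts would
    give a sparse whole. So an inclusion-minimal dense set has no such cut. *)
Lemma dense_minimal a b S U0 : U0 != set0 -> a * #|U0| <= b * #|inside S U0|.+1 ->
  exists U, [/\ U \subset U0, U != set0, a * #|U| <= b * #|inside S U|.+1 &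
    two_connected ends U (inside S U)].
Proof.
move=> U00 dU0.
have [|U [UU0 /andP[Un0 dU] mU]] := @minimal_set
   (fun U => (U != set0) && (a * #|U| <= b * #|inside S U|.+1)) U0; first by rewrite U00.
exists U; split=> //; split; first by move=> f; rewrite inE => /andP[].
move=> W WU W0 WnU; rewrite leqNgt; apply/negP => c1.
have dW : b * #|inside S W|.+1 < a * #|W|.
  rewrite ltnNge; apply/negP => dW; move/eqP: WnU; apply; apply: mU => //.
  by rewrite W0.
have dW' : b * #|inside S (U :\: W)|.+1 < a * #|U :\: W|.
  rewrite ltnNge; apply/negP => dW'.
  have : U :\: W = U.
    apply: mU; first exact: subsetDl.
    rewrite dW' andbT; apply: contra WnU; rewrite setD_eq0 => UW.
    by rewrite eqEsubset WU.
  move/setDidPl; rewrite -setI_eq0 => /eqP UW0; move: W0.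
  by rewrite -(setIidPr WU) UW0 eqxx.
have := inside_split S WU; have := cardsID W U; rewrite (setIidPr WU) => e1 e2.
move: dU; rewrite leqNgt => /negP; apply; rewrite -e1 e2 mulnDr.
apply: leq_ltn_trans (_ : b * #|inside S W|.+1 + b * #|inside S (U :\: W)|.+1 < _); last by lia.
by rewrite -mulnDr leq_mul2l; apply/orP; right; lia.
Qed.

Lemma card_degrees U :
  3 * #|U| = 2 * #|[set f | ins ends U f]| + #|[set f | bd ends U f]|.
Proof.
rewrite mulnC -[#|U|]sum1_card big_distrl /= (eq_bigr (fun v => \sum_f bd ends [set v] f)); last first.
  move=> v _; rewrite mul1n -{1}(cub v) -sum1_card big_mkcond /=.
  by apply: eq_bigr => f _; rewrite inE; case: (bd _ _ _).
rewrite exchange_big /= (eq_bigr (fun f => 2 * ins ends U f + bd ends U f)); last first.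
  by move=> f _; rewrite star_card // /bd /ins; do 2 case: (_ \in U).
rewrite big_split /= -big_distrr /=.
have card_sum (p : pred E) : \sum_f p f = #|[set f | p f]|.
  by rewrite -sum1_card big_mkcond [RHS]big_mkcond /=; apply: eq_bigr => f _; rewrite inE; case: (p f).
by rewrite !card_sum.
Qed.

Hypothesis three_connected : forall U, U != set0 -> U != setT -> 3 <= #|[set f | bd ends U f]|.

Lemma edges_of_subset U : U != set0 -> U != setT ->
  2 * #|[set f | ins ends U f]| + 3 <= 3 * #|U|.
Proof. by move=> U0 UT; rewrite card_degrees leq_add2l three_connected. Qed.

Lemma inside_le S U : #|inside S U| <= #|[set f | ins ends U f]|.
Proof. by apply: subset_leq_card; apply/subsetP => f; rewrite !inE => /andP[]. Qed.

Lemma sub_not_setT U W : U \subset W -> W != setT -> U != setT.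
Proof. by move=> UW; apply: contraNneq => UT; rewrite -subTset -UT. Qed.

Lemma inside_setT U : inside setT U = [set f | ins ends U f].
Proof. by apply/setP => f; rewrite !inE. Qed.

(* The constants are such that a second reduction, after the deletion of one
   edge, still leaves a set with more edges than vertices. *)
Lemma dense_gadget U0 : U0 != set0 -> U0 != setT ->
  44 * #|U0| <= 30 * #|[set f | ins ends U0 f]|.+1 -> gadget U0.
Proof.
move=> U00 U0T; rewrite -inside_setT => /(dense_minimal U00) [U [UU0 Un0 dU US]].
have UT := sub_not_setT UU0 U0T.
have eU := edges_of_subset Un0 UT; rewrite -inside_setT in eU.
case: (pselect (forall f, f \in inside setT U ->
    exists y, [/\ zero_sum ends (inside setT U) y, boxed y & y f = 1%R])) => [H|].
  by apply: (gadget_intro UU0 US) => //; lia.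
move=> /existsNP [g /not_implyP [gS ng]].
have [//|[A SA]] := even_walk noloop US gS.
pose S := setT :\ g.
have cS : #|inside setT U| = #|inside S U|.+1.
  rewrite (cardsD1 g) gS add1n; congr _.+1; apply: eq_card => f.
  by rewrite !inE andbT.
(* Density 44/30 together with [edges_of_subset] forces [#|U| >= 15], and then weakening the ratio
   to 14/10 pays for the lost edge. Likewise [#|U2| >= 5], which gives more edges than vertices. *)
have [|U2 [U2U U20 dU2 U2S]] := @dense_minimal 14 10 S U Un0; first by lia.
have U2T := sub_not_setT U2U UT.
have eU2 := edges_of_subset U20 U2T; have := inside_le S U2 => le2.
apply: (gadget_intro (subset_trans U2U UU0) U2S); first by clear -dU2 eU2 le2; lia.
move=> f fS; apply: (even_walk_bipartite (C := A) noloop U2S fS) => h.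
rewrite !inE andbT => /andP[hg hU2].
by rewrite SA // !inE (ins_sub U2U hU2).
Qed.

Definition conn T := T != set0 /\ forall Z, Z \subset T -> Z != set0 -> Z != T ->
  exists2 f, ins ends T f & bd ends Z f.

(** [C] is one colour class of the tree [S]. The last clause is acyclicity as an edge count, the
    form that survives adding edges between two trees. *)
Lemma spanning_tree T : conn T -> exists S C, [/\ forall f, f \in S -> ins ends T f,
   forall f, f \in S -> bd ends C f, #|S|.+1 = #|T| &
   forall W, W :&: T != set0 -> #|inside S W| < #|W :&: T|].
Proof.
move=> [T0 cT].
suff H n : n < #|T| -> exists T1 S C, [/\ T1 \subset T, #|T1| = n.+1, #|S|.+1 = #|T1| &
   [/\ forall f, f \in S -> ins ends T1 f, forall f, f \in S -> bd ends C f &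
   forall W, W :&: T1 != set0 -> #|inside S W| < #|W :&: T1|]].
  have [|T1 [S [C [T1T cT1 cS [H1 H2 H3]]]]] := H #|T|.-1.
    by rewrite ltn_predL card_gt0.
  have TE : T1 = T by apply/eqP; rewrite eqEcard T1T cT1 prednK ?card_gt0 ?leqnn.
  by exists S, C; rewrite -TE.
elim: n => [_|n IH cn].
  have [x xT] := set0Pn _ T0.
  exists [set x], set0, set0; split.
  - by rewrite sub1set.
  - by rewrite cards1.
  - by rewrite cards1 cards0.
  split; try by move=> f; rewrite inE.
  move=> W; rewrite -card_gt0; apply: leq_trans; rewrite ltnS leqn0 cards_eq0.
  by apply/eqP/setP => f; rewrite !inE.
have [T1 [S [C [T1T cT1 cS [S1 S2 S3]]]]] := IH (ltnW cn).
have [||f fT bf] := cT T1 T1T.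
- by rewrite -card_gt0 cT1.
- by apply: contraTneq cn => e; rewrite -e cT1 ltnn.
have [a [z [aT1 zT1 zT Jf]]] : exists a z, [/\ a \in T1, z \notin T1, z \in T & joined ends f a z].
  have J := joined_ends noloop f; move: bf; rewrite /bd.
  case/andP: fT => p q; case: (boolP ((ends f).1 \in T1)) => pT /=.
    by move=> qT; exists (ends f).1, (ends f).2.
  by move=> qT; exists (ends f).2, (ends f).1; split=> //; apply: joinedC.
have az : a != z by case: Jf.
have fS : f \notin S.
  apply/negP => /S1 /andP[p q].
  by case: (joinedP Jf) => -[e1 e2]; move: zT1; rewrite -?e1 -?e2 ?p ?q.
exists (z |: T1), (f |: S), (if a \in C then C :\ z else z |: C); split.
- by rewrite subUset sub1set zT.
- by rewrite cardsU1 zT1 cT1.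
- by rewrite !cardsU1 zT1 fS -cS.
split.
- move=> h; rewrite !inE => /orP[/eqP ->|/S1 /andP[p q]].
    by case: (joinedP Jf) => -[e1 e2]; rewrite /ins !inE e1 e2 eqxx aT1 ?orbT.
  by rewrite /ins !inE p q !orbT.
- move=> h; rewrite !inE => /orP[/eqP ->|hS].
    have [_ ->] := Jf; case: (boolP (a \in C)) => aC; rewrite !inE eqxx ?aC ?(negbTE aC) ?az ?(negbTE az) //.
  have /andP[p q] := S1 h hS; move: (S2 h hS); rewrite /bd.
  have pz : (ends h).1 != z by apply: contraNneq zT1 => <-.
  have qz : (ends h).2 != z by apply: contraNneq zT1 => <-.
  by case: ifP => _; rewrite !inE ?(negbTE pz) ?(negbTE qz) ?pz ?qz.
- move=> W WT1.
  have cin : #|inside (f |: S) W| = ins ends W f + #|inside S W|.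
    case: (boolP (ins ends W f)) => fW.
      have -> : inside (f |: S) W = f |: inside S W.
        by apply/setP => h; rewrite !inE andb_orl; case: eqP => [->|//]; rewrite fW.
      by rewrite cardsU1 [f \in _]inE (negbTE fS).
    apply: eq_card => h; rewrite !inE andb_orl.
    by case: eqP => [->|//]; rewrite (negbTE fW) !andbF.
  have fza : ins ends W f = (a \in W) && (z \in W).
    by case: (joinedP Jf) => -[e1 e2]; rewrite /ins e1 e2 // andbC.
  have WE : W :&: (z |: T1) = if z \in W then z |: (W :&: T1) else W :&: T1.
    by apply/setP => h; case: ifP => zW; rewrite !inE; case: eqP => [->|]; rewrite ?zW.
  rewrite cin fza; case: (boolP (z \in W)) WE => zW WE; last first.
    by rewrite andbF add0n WE; apply: S3; rewrite -WE.
  rewrite WE andbT cardsU1 !inE (negbTE zT1) andbF /= add1n ltnS.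
  case: (eqVneq (W :&: T1) set0) => WT0.
    have aW : a \notin W.
      by apply/negP => aW; have := in_set0 a; rewrite -WT0 inE aW aT1.
    rewrite (negbTE aW) WT0 cards0 leqn0 cards_eq0; apply/eqP/setP => h; rewrite !inE.
    apply/negbTE/negP => /andP[/S1 /andP[p _] /andP[pW _]].
    by have := in_set0 (ends h).1; rewrite -WT0 inE p pW.
  by have := S3 W WT0; case: (a \in W); rewrite ?add1n ?add0n // => /ltnW.
Qed.

Lemma inside_disjoint S W T : (forall f, f \in S -> ins ends T f) ->
  W :&: T = set0 -> inside S W = set0.
Proof.
move=> ST WT; apply/setP => f; rewrite !inE; apply/negbTE/negP => /andP[/ST /andP[p _] /andP[q _]].
by have := in_set0 (ends f).1; rewrite -WT inE p q.
Qed.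

(* Three crossing edges with the same colour pattern close the two trees to a
   bipartite theta graph, whose branch vertices are the possible choices for [w]. *)
Lemma pair_gadget T T' : conn T -> conn T' -> [disjoint T & T'] ->
  5 <= #|[set f | bd ends T f && bd ends T' f]| -> gadget (T :|: T').
Proof.
move=> cT cT' dT c5.
have [S1 [C1 [i1 b1 k1 w1]]] := spanning_tree cT.
have [S2 [C2 [i2 b2 k2 w2]]] := spanning_tree cT'.
set X0 := [set f | _] in c5.
have TT' v : v \in T -> v \notin T' by move=> vT; rewrite (disjointFr dT vT).
have [C [X [XX0 cX bX bS1 bS2]]] : exists C X, [/\ X \subset X0, #|X| = 3,
    forall f, f \in X -> bd ends C f, forall f, f \in S1 -> bd ends C f &
    forall f, f \in S2 -> bd ends C f].
  (* The flag swaps the colours of the second tree. Each connecting edge is bichromatic for exactly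
     one of the two colourings, so one of them serves three of the five. *)
  pose C b := (C1 :&: T) :|: (if b then C2 :&: T' else T' :\: C2).
  have H b : 2 < #|[set f in X0 | bd ends (C b) f]| -> exists C X, [/\ X \subset X0, #|X| = 3,
    forall f, f \in X -> bd ends C f, forall f, f \in S1 -> bd ends C f &
    forall f, f \in S2 -> bd ends C f].
    case/card_gt2P => f1 [f2 [f3 [[]]]]; rewrite !in_set => /andP[m1 n1] /andP[m2 n2] /andP[m3 n3] [d12 d23 d31].
    exists (C b), [set f1; f2; f3]; split.
    - by apply/subsetP => f; rewrite !(in_setU, in_set1) => /orP[/orP[]|] /eqP -> //; rewrite in_set.
    - by rewrite -setUA cardsU1 cards2 !inE negb_or d12 d23 eq_sym d31.
    - by move=> f; rewrite !(in_setU, in_set1) => /orP[/orP[]|] /eqP ->.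
    - move=> f fS; have /andP[p q] := i1 f fS; move: (b1 f fS); rewrite /bd /C.
      by case: (b); rewrite !inE p q (negbTE (TT' _ p)) (negbTE (TT' _ q)) ?andbF ?orbF ?andbT.
    - move=> f fS; have /andP[p q] := i2 f fS; move: (b2 f fS); rewrite /bd /C.
      have pT : (ends f).1 \in T = false by apply/negbTE/negP => /TT'; rewrite p.
      have qT : (ends f).2 \in T = false by apply/negbTE/negP => /TT'; rewrite q.
      by case: (b); rewrite !inE p q pT qT ?andbF ?andbT //=; do 2 case: (_ \in C2).
  have e5 : #|X0| = #|[set f in X0 | bd ends (C true) f]| + #|[set f in X0 | bd ends (C false) f]|.
    rewrite -[LHS](cardsID [set f | bd ends (C true) f]); congr (_ + _); apply: eq_card => f; rewrite !inE /bd.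
      by [].
    rewrite /C !inE.
    have := TT' (ends f).1; have := TT' (ends f).2.
    by do 2 case: (_ \in T); do 2 case: (_ \in T'); do 2 case: (_ \in C1); do 2 case: (_ \in C2);
      move=> h1 h2; first [ by [] | by have := h1 isT | by have := h2 isT ].
  case: (ltnP 2 #|[set f in X0 | bd ends (C true) f]|) => c3; first exact: (H true).
  by apply: (H false); lia.
pose S := S1 :|: S2 :|: X; pose U0 := T :|: T'.
have xW W : inside X W != set0 -> (W :&: T != set0) && (W :&: T' != set0).
  case/set0Pn => f; rewrite !inE => /andP[/(subsetP XX0)]; rewrite inE /bd => fX /andP[p q].
  have := TT' (ends f).1; have := TT' (ends f).2 => t1 t2.
  apply/andP; split; apply/set0Pn.
    case: (boolP ((ends f).1 \in T)) => pT; first by exists (ends f).1; rewrite inE p pT.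
    by exists (ends f).2; move: fX; rewrite inE q (negbTE pT) /= => /andP[-> _].
  case: (boolP ((ends f).1 \in T')) => pT; first by exists (ends f).1; rewrite inE p pT.
  by exists (ends f).2; move: fX; rewrite inE q (negbTE pT) /= => /andP[_ ->].
(* The first connecting edge only joins the two forests; just the further ones can close cycles. *)
have forest W : W != set0 -> W \subset U0 -> #|inside S W| < #|W| + (0 < #|inside X W|) * #|inside X W|.-1.
  move=> W0 WU.
  have cW : #|W| = #|W :&: T| + #|W :&: T'|.
    by rewrite -[in LHS](setIidPl WU) setIUr cardsU setIACA setIid (disjoint_setI0 dT) setI0 cards0 subn0.
  have cS : #|inside S W| <= #|inside S1 W| + #|inside S2 W| + #|inside X W|.
    have -> : inside S W = inside S1 W :|: inside S2 W :|: inside X W.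
      by apply/setP => f; rewrite !inE !andb_orl.
    by rewrite (leq_trans (leq_card_setU _ _).1) // leq_add2r (leq_card_setU _ _).1.
  have z1 : W :&: T = set0 -> #|inside S1 W| = 0.
    by move=> WT; rewrite (inside_disjoint i1 WT) cards0.
  have z2 : W :&: T' = set0 -> #|inside S2 W| = 0.
    by move=> WT; rewrite (inside_disjoint i2 WT) cards0.
  case: (posnP #|inside X W|) => [x0|xpos].
    rewrite mul0n addn0; case: (eqVneq (W :&: T) set0) => WT.
      have WT' : W :&: T' != set0.
        apply: contraNneq W0 => WT'; rewrite -cards_eq0 cW WT WT' cards0 //.
      have := w2 W WT'; rewrite z1 // in cS; lia.
    have := w1 W WT; case: (eqVneq (W :&: T') set0) => WT'.
      by rewrite z2 // in cS; lia.
    by have := w2 W WT'; lia.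
  have : inside X W != set0 by rewrite -card_gt0.
  by case/xW/andP => /w1 l1 /w2 l2; lia.
have cXW W : W \subset U0 -> #|inside X W| <= #|X|.
  by move=> _; apply: subset_leq_card; apply/subsetP => f; rewrite inE => /andP[].
have k12 : #|S| = #|U0|.+1.
  have cU0 : #|U0| = #|T| + #|T'| by rewrite cardsU (disjoint_setI0 dT) cards0 subn0.
  have d12 : S1 :&: S2 = set0.
    apply/setP => f; rewrite !inE; apply/negbTE/negP => /andP[/i1 /andP[p _] /i2 /andP[q _]].
    by move: (TT' _ p); rewrite q.
  have d3 : (S1 :|: S2) :&: X = set0.
    apply/setP => f; rewrite !inE; apply/negbTE/negP => /andP[/orP[/i1|/i2] /andP[p q] /(subsetP XX0)];
      by rewrite inE /bd p q ?andbF.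
  by rewrite /S cardsU d3 cards0 subn0 cardsU d12 cards0 subn0 cX cU0 -k1 -k2; lia.
have S0 : inside S U0 = S.
  apply/setP => f; rewrite inE; case: (boolP (f \in S)) => //=; rewrite !in_setU => fS.
  rewrite /ins !in_setU; case/orP: fS => [/orP[/i1|/i2] /andP[-> ->]|/(subsetP XX0)].
  - by [].
  - by rewrite !orbT.
  rewrite inE /bd; have := TT' (ends f).1; have := TT' (ends f).2.
  by do 2 case: (_ \in T); do 2 case: (_ \in T');
    move=> h1 h2; first [ by [] | by have := h1 isT | by have := h2 isT ].
have T0 : U0 != set0.
  case: cT => /set0Pn [v vT] _; apply/set0Pn; exists v; by rewrite inE vT.
have [|U [UU0 /andP[Un0 dU] mU]] := @minimal_set
   (fun U => (U != set0) && (#|U| < #|inside S U|)) U0; first by rewrite T0 S0 k12 /=.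
have US : two_connected ends U (inside S U).
  split; first by move=> f; rewrite inE => /andP[].
  move=> W WU W0 WnU; rewrite leqNgt; apply/negP => c1.
  have e1 := inside_split S WU; have := cardsID W U; rewrite (setIidPr WU) => e2.
  have le1 : #|inside S W| <= #|W|.
    rewrite leqNgt; apply/negP => h; move/eqP: WnU; apply; apply: mU => //.
    by rewrite W0.
  have W'0 : U :\: W != set0.
    by apply: contra WnU; rewrite setD_eq0 => UW; rewrite eqEsubset WU.
  have le2 : #|inside S (U :\: W)| <= #|U :\: W|.
    rewrite leqNgt; apply/negP => h.
    have : U :\: W = U by apply: mU; rewrite ?subsetDl ?W'0.
    move/setDidPl; rewrite -setI_eq0 => /eqP UW0; move: W0.
    by rewrite -(setIidPr WU) UW0 eqxx.
  have f1 := forest W W0 (subset_trans WU UU0).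
  have f2 := forest _ W'0 (subset_trans (subsetDl U W) UU0).
  have x3 : #|inside X W| + #|inside X (U :\: W)| <= 3.
    rewrite -cX -cardsUI (_ : _ :&: _ = set0) ?cards0 ?addn0; last first.
      apply/setP => f; rewrite !inE; apply/negbTE/negP => /andP[/andP[_ /andP[p _]] /andP[_ /andP[]]].
      by rewrite inE p.
    apply: subset_leq_card; apply/subsetP => f; rewrite !inE => /orP[] /andP[] //.
  (* With at most one edge across, both parts would have as many edges as vertices, so each would
     contain two of the three connecting edges. *)
  by case: (posnP #|inside X W|) => x1; case: (posnP #|inside X (U :\: W)|) => x2;
    rewrite ?x1 ?x2 ?mul0n ?addn0 in f1 f2 x3; clear -dU c1 e1 e2 le1 le2 f1 f2 x3 x1 x2; lia.
apply: (gadget_intro UU0 US dU) => f fS.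
apply: (even_walk_bipartite (C := C) noloop US fS) => h.
by rewrite inE => /andP[]; rewrite !in_setU => /orP[/orP[/bS1|/bS2]|/bX].
Qed.




End Gadgets.


(** * Short edge-cuts of cyclically 4-edge-connected cubic graphs *)

Section Cycles.
Variables (V E : finType) (ends : E -> V * V).
Hypothesis noloop : loopless ends.
Implicit Types (U W X Z : {set V}).

Definition path_in X k (vs : nat -> V) (es : nat -> E) :=
  [/\ forall i, i <= k -> vs i \in X,
      forall i j, i <= k -> j <= k -> vs i = vs j -> i = j &
      forall i, i < k -> joined ends (es i) (vs i) (vs i.+1)].

Lemma joined_joins f a b : joined ends f a b -> joins ends f a b.
Proof.
rewrite /joins => /joinedP [] [<- <-]; rewrite -surjective_pairing eqxx ?orbT //.
Qed.

Lemma joined_uniq f a b c d : joined ends f a b -> joined ends f c d ->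
  (a = c /\ b = d) \/ (a = d /\ b = c).
Proof.
by move=> /joinedP [] [<- <-] /joinedP [] [-> ->]; [left|right|right|left].
Qed.

(** [f] only has to differ from the last edge of the path; a parallel edge is welcome and closes a
    cycle of length two. *)
Lemma closed_path X k vs es i f : path_in X k vs es -> i < k ->
  joined ends f (vs k) (vs i) -> f != es k.-1 -> has_cycle_in ends X.
Proof.
move=> [vX vinj esJ] ik Jf fe.
pose m := k - i; have mE : k = i + m by rewrite subnKC // ltnW.
have m0 : 0 < m by rewrite subn_gt0.
have mK : (m.-1).+2 = m.+1 by rewrite prednK.
have le (j : 'I_m.-1.+2) : i + j <= k.
  by have := ltn_ord j; rewrite [X in _ < X]mK mE leq_add2l ltnS.
pose es' (j : 'I_m.-1.+2) := if j < m then es (i + j) else f.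
have ends_inj a b : a < k -> b < k -> es a = es b -> a = b.
  move=> ak bk eab; have J1 := esJ a ak; have J2 := esJ b bk; rewrite -eab in J2.
  case: (joined_uniq J1 J2) => [[e1 _]|[e1 e2]]; first by apply: vinj; rewrite // ltnW.
  have := vinj _ _ (ltnW ak) bk e1; have := vinj _ _ ak (ltnW bk) e2; lia.
have f_new a : a < k -> f <> es a.
  move=> ak fa; have J1 := esJ a ak; rewrite -fa in J1.
  case: (joined_uniq Jf J1) => -[e1 e2].
    by have := vinj _ _ (leqnn k) (ltnW ak) e1; lia.
  have := vinj _ _ (leqnn k) ak e1 => ka.
  by move: fe; rewrite fa ka /= eqxx.
have lt j : j < m -> i + j < k by rewrite mE ltn_add2l.
have last_m (j : 'I_m.-1.+2) : j < m = false -> j = m :> nat.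
  by move=> jm; have := ltn_ord j; lia.
exists m.-1, (fun j => vs (i + j)), es'; split.
  move=> j1 j2 /(vinj _ _ (le j1) (le j2)) /addnI e; exact: val_inj.
split.
  move=> j1 j2; rewrite /es'; case: ifP => h1; case: ifP => h2 e.
  - apply/val_inj/(@addnI i); apply: ends_inj => //; exact: lt.
  - by exfalso; apply: (f_new (i + j1)); [exact: lt|rewrite e].
  - by exfalso; apply: (f_new (i + j2)); [exact: lt|rewrite e].
  - by apply: val_inj; rewrite /= (last_m _ h1) (last_m _ h2).
split; first by move=> j; apply: vX.
move=> j; rewrite /es'; case: ifP => h; apply: joined_joins.
  rewrite /= modn_small; last by rewrite [X in _ < X]mK ltnS.
  by rewrite addnS; apply: esJ; exact: lt.
rewrite /= (last_m _ h) mK modnn addn0 -mE; exact: Jf.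
Qed.

(** Deleting a vertex of degree at most one keeps the inequality, so a minimal set has minimum
    degree two; there the last vertex of a longest path sends another edge back to the path. *)
Lemma cycle_of_many_edges X : X != set0 -> #|X| <= #|[set f | ins ends X f]| ->
  has_cycle_in ends X.
Proof.
move=> X0 eX.
have [|Y [YX /andP[Y0 eY] mY]] := @minimal_set V
   (fun Y => (Y != set0) && (#|Y| <= #|[set f | ins ends Y f]|)) X; first by rewrite X0.
have cyc_sub : has_cycle_in ends Y -> has_cycle_in ends X.
  case=> k [vs [es [h1 [h2 [h3 h4]]]]]; exists k, vs, es; do 3 split=> //.
  by move=> i; apply: (subsetP YX).
apply: cyc_sub.
have deg2 v : v \in Y -> 1 < #|[set f | ins ends Y f && bd ends [set v] f]|.
  move=> vY; rewrite ltnNge; apply/negP => le1.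
  have sp : #|[set f | ins ends Y f]| =
      #|[set f | ins ends Y f && bd ends [set v] f]| + #|[set f | ins ends (Y :\ v) f]|.
    rewrite -[LHS](cardsID [set f | bd ends [set v] f]); congr (_ + _); apply: eq_card => f; rewrite !inE //.
    rewrite /ins /bd !inE; have := noloop f.
    case: (eqVneq (ends f).1 v) => [->|_]; case: (eqVneq (ends f).2 v) => [->|_];
      rewrite ?eqxx ?andbF //=.
  case: (eqVneq (Y :\ v) set0) => Yv.
    have Yv1 : Y = [set v] by apply/setP => z; rewrite -(setD1K vY) Yv setU0.
    have : #|[set f | ins ends Y f]| = 0.
      apply/eqP; rewrite cards_eq0; apply/eqP/setP => f; rewrite !inE Yv1 /ins !inE.
      by apply/negbTE/negP => /andP[/eqP p /eqP q]; have := noloop f; rewrite p q eqxx.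
    by move: eY; rewrite Yv1 cards1 => + e; rewrite e.
  have : Y :\ v = Y.
    apply: mY; first exact: subD1set.
    by rewrite Yv /=; move: eY; rewrite sp (cardsD1 v Y) vY; lia.
  by move=> e; have := setD11 v Y; rewrite e vY.
have [x xY] := set0Pn _ Y0.
have [f0 _] : exists f : E, true.
  have /card_gt0P [f _] := ltnW (deg2 x xY); by exists f.
pose P k := `[< exists vs es, path_in Y k vs es >].
have P0 : exists k, P k.
  exists 0; apply/asboolP; exists (fun=> x), (fun=> f0); split=> //.
  by move=> i j; rewrite !leqn0 => /eqP -> /eqP ->.
have Pb k : P k -> k <= #|V|.
  move=> /asboolP [vs [es [_ vinj _]]].
  suff : #|[set vs i | i : 'I_k.+1]| = k.+1.
    by move=> e; apply: ltnW; rewrite -e max_card.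
  rewrite card_imset ?card_ord // => i j /vinj e; apply: val_inj; apply: e;
    by rewrite -ltnS ltn_ord.
case: (ex_maxnP P0 Pb) => k /asboolP [vs [es vsP]] kmax.
have [vY vinj esJ] := vsP.
have kY := vY k (leqnn k).
(* For [k = 0] the excluded edge is an arbitrary one, which is harmless. *)
have [f [fY bf fe]] : exists f, [/\ ins ends Y f, bd ends [set vs k] f & f != es k.-1].
  have : 0 < #|[set f | ins ends Y f && bd ends [set vs k] f] :\ es k.-1|.
    have := deg2 _ kY; rewrite (cardsD1 (es k.-1)); case: (_ \in _); lia.
  by case/card_gt0P => f; rewrite !inE => /and3P[fe fY bf]; exists f.
have [z [zY Jf]] : exists z, z \in Y /\ joined ends f (vs k) z.
  have J := joined_ends noloop f; have /andP[p q] := fY.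
  move: bf; rewrite /bd !inE; case: eqP => [<-|_] /=; first by exists (ends f).2.
  by move=> /eqP <-; exists (ends f).1; split=> //; apply: joinedC.
case: (pselect (exists2 i, i <= k & vs i = z)) => [[i ik iz]|nz].
  apply: (closed_path vsP (i := i) _ _ fe); last by rewrite iz.
  rewrite ltn_neqAle ik andbT; apply: contraTneq isT => ik'.
  by case: Jf; rewrite -iz ik' eqxx.
have : P k.+1; last by move/kmax; rewrite ltnn.
apply/asboolP; exists (fun i => if i == k.+1 then z else vs i), (fun i => if i == k then f else es i).
split.
- by move=> i ik; case: eqP => // ik'; apply: vY; clear -ik ik'; lia.
- move=> i j ik jk; case: eqP => i1; case: eqP => j1 //; first by rewrite i1 j1.
  + by move=> e; case: nz; exists j => //; clear -jk j1; lia.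
  + by move=> e; case: nz; exists i => //; clear -ik i1; lia.
  + by apply: vinj; clear -ik jk i1 j1; lia.
- move=> i ik; case: (eqVneq i k) => [->|ik'].
    by rewrite eqxx (ltn_eqF (ltnSn k)).
  have -> : (i == k.+1) = false by apply/eqP; clear -ik; lia.
  rewrite eqSS (negbTE ik'); apply: esJ; clear -ik ik'; lia.
Qed.

Hypothesis cubG : cubic ends.
Hypothesis cyc4 : cyclically_k_edge_connected ends 4.

Lemma edge_cutE X : edge_cut ends X = [set f | bd ends X f].
Proof. by apply/setP => f; rewrite !inE /bd; do 2 case: (_ \in X). Qed.

Lemma incidentE v f : incident ends v f = bd ends [set v] f.
Proof.
rewrite /incident /bd !inE; have := noloop f.
by case: (eqVneq (ends f).1 v) => [->|_] //=; rewrite eq_sym => /negbTE ->.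
Qed.

Lemma cubic_star v : #|[set f | bd ends [set v] f]| = 3.
Proof.
by rewrite -(cubG v) /degree; apply: eq_card => f; rewrite !inE incidentE.
Qed.

Lemma boundaryC X : [set f | bd ends (~: X) f] = [set f | bd ends X f].
Proof. by apply/setP => f; rewrite !inE bdC. Qed.

(** An acyclic set has at most [#|X| - 1] inner edges, which take at most [2 * #|X| - 2] of its
    [3 * #|X|] edge ends. *)
Lemma acyclic_boundary X : X != set0 -> ~ has_cycle_in ends X ->
  #|X| + 2 <= #|[set f | bd ends X f]|.
Proof.
move=> X0 nX; have := card_degrees noloop cubic_star X.
have : #|[set f | ins ends X f]| < #|X|.
  by rewrite ltnNge; apply/negP => /(cycle_of_many_edges X0).
lia.
Qed.

Lemma boundary_cases X : X != set0 -> X != setT ->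
  [\/ 4 <= #|[set f | bd ends X f]|, #|X| + 2 <= #|[set f | bd ends X f]| |
      #|~: X| + 2 <= #|[set f | bd ends X f]|].
Proof.
move=> X0 XT.
case: (pselect (has_cycle_in ends X)) => cX; last by constructor 2; apply: acyclic_boundary.
case: (pselect (has_cycle_in ends (~: X))) => cX'.
  by constructor 1; rewrite -edge_cutE; apply: cyc4.
constructor 3; rewrite -boundaryC; apply: acyclic_boundary => //.
by apply: contra XT => /eqP e; rewrite -[X]setCK e setC0.
Qed.

Lemma boundary_ge3 X : X != set0 -> X != setT -> 3 <= #|[set f | bd ends X f]|.
Proof.
move=> X0 XT; case: (boundary_cases X0 XT) => H; first exact: ltnW.
  by have := X0; rewrite -card_gt0; lia.
have : 0 < #|~: X|; last by lia.
by rewrite card_gt0; apply: contra XT => /eqP e; rewrite -[X]setCK e setC0.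
Qed.

Lemma order_even_cubic : odd #|V| = false.
Proof.
have := card_degrees noloop cubic_star setT; rewrite cardsT.
have -> : [set f | bd ends setT f] = set0 by apply/setP => f; rewrite !inE /bd !inE.
rewrite cards0 addn0 => /(congr1 odd); by rewrite oddM mul2n odd_double.
Qed.

(** The boundary has the parity of [#|X|], so four improves to five; an acyclic shore has at least
    three vertices and thus at least five boundary edges. *)
Lemma boundary_ge5 X : odd #|X| -> 1 < #|X| -> 1 < #|~: X| ->
  5 <= #|[set f | bd ends X f]|.
Proof.
move=> oX X1 X1'.
have oX' : odd #|~: X|.
  by have := order_even_cubic; rewrite -(cardsC X) oddD oX; case: (odd _).
have X0 : X != set0 by rewrite -card_gt0; lia.
have XT : X != setT by apply: contraTneq X1' => ->; rewrite setCT cards0.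
have ob : odd #|[set f | bd ends X f]|.
  have := card_degrees noloop cubic_star X => /(congr1 odd).
  by rewrite oddM oX oddD mul2n odd_double /= => <-.
have X3 : 2 < #|X| by case: #|X| oX X1 => [|[|[|]]].
have X3' : 2 < #|~: X| by case: #|~: X| oX' X1' => [|[|[|]]].
by case: (boundary_cases X0 XT) => H; lia.
Qed.

Lemma conn_setT (v : V) : conn ends setT.
Proof.
split; first by apply/set0Pn; exists v.
move=> Z _ Z0 ZT; have /ltnW /ltnW := boundary_ge3 Z0 ZT.
by case/card_gt0P => f; rewrite inE => bf; exists f => //; rewrite /ins !inE.
Qed.

End Cycles.


(** * Partition into connected clusters *)

Section Clusters.
Variables (V E : finType) (ends : E -> V * V).
Hypothesis noloop : forall f, (ends f).1 != (ends f).2.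
Hypothesis cub : forall v, #|[set f | bd ends [set v] f]| = 3.
Implicit Types (U W X Y Z T K : {set V}).

Lemma conn_union U W f : conn ends U -> conn ends W ->
  (exists a b, [/\ a \in U, b \in W & joined ends f a b]) -> conn ends (U :|: W).
Proof.
move=> [U0 cU] [W0 cW] [a [b [aU bW Jf]]]; split.
  by apply/set0Pn; exists a; rewrite inE aU.
have step S T : conn ends S -> S \subset T -> forall Z, Z :&: S != set0 -> ~~ (S \subset Z) ->
    exists2 h, ins ends T h & bd ends Z h.
  move=> [S0 cS] ST Z ZS nS; have [|h hS bh] := cS (Z :&: S) (subsetIr _ _) ZS.
    by apply: contra nS => /eqP <-; exact: subsetIl.
  exists h; first exact: ins_sub hS.
  by move: bh; case/andP: hS => p q; rewrite /bd !inE p q !andbT.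
move=> Z ZUW Z0 ZnUW.
case: (eqVneq (Z :&: U) set0) => [ZU|ZU].
  have ZW : Z :&: W != set0.
    by apply: contra Z0 => /eqP ZW; rewrite -(setIidPl ZUW) setIUr ZU ZW setU0.
  case: (boolP (W \subset Z)) => [/subsetP WZ|]; last by apply: step => //; rewrite ?subsetUr.
  exists f; first by case: (joinedP Jf) => -[e1 e2]; rewrite /ins e1 e2 !inE aU bW ?orbT.
  have [_ ->] := Jf; rewrite (WZ b bW); case: (boolP (a \in Z)) => // aZ.
  by have := in_set0 a; rewrite -ZU inE aZ aU.
case: (boolP (U \subset Z)) => [UZ|]; last by apply: step => //; rewrite ?subsetUl.
case: (eqVneq (Z :&: W) set0) => [ZW|ZW].
  exists f; first by case: (joinedP Jf) => -[e1 e2]; rewrite /ins e1 e2 !inE aU bW ?orbT.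
  have [_ ->] := Jf; rewrite (subsetP UZ a aU); case: (boolP (b \in Z)) => // bZ.
  by have := in_set0 b; rewrite -ZW inE bZ bW.
apply: step ZW _ => //; first exact: subsetUr.
apply: contra ZnUW => WZ; by rewrite eqEsubset ZUW subUset UZ WZ.
Qed.

Section Components.
Variables (T : {set V}) (a : V).
Hypothesis cT : conn ends T.
Hypothesis aT : a \in T.

(* A union of components of [T] minus [a]. *)
Definition detached Z := forall f, ins ends T f -> bd ends Z f -> bd ends [set a] f.
Definition links Z := [set f | [&& ins ends T f, bd ends Z f & bd ends [set a] f]].

Lemma detached_sub Y Z : Z \subset T :\ a -> detached Z -> Y \subset Z ->
  (forall f, ins ends Z f -> ~~ bd ends Y f) -> detached Y.
Proof.
move=> ZT dZ /subsetP YZ nY f fT bf; apply: dZ => //; apply/negPn/negP => nb.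
suff : ins ends Z f by move/nY; rewrite bf.
have y1 := YZ (ends f).1; have y2 := YZ (ends f).2.
move: bf nb y1 y2; rewrite /bd /ins.
by do 2 case: (_ \in Y); do 2 case: (_ \in Z); move=> h1 h2 h3 h4;
  first [ by [] | by have := h3 isT | by have := h4 isT ].
Qed.

(** Every component of [T] minus [a] has a link to [a], and by averaging some component has at least
    [s] vertices per link. A disconnected [Z] is split, and one part keeps the ratio. *)
Lemma big_component s Z : Z != set0 -> Z \subset T :\ a -> detached Z ->
  #|links Z| * s <= #|Z| ->
  exists K, [/\ K \subset Z, conn ends K, detached K & s <= #|K|].
Proof.
have [n] := ubnP #|Z|; elim: n Z => // n IH Z; rewrite ltnS => cZ Z0 ZT dZ le.
have aZ : a \notin Z by apply/negP => /(subsetP ZT); rewrite !inE eqxx.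
have l0 : 0 < #|links Z|.
  have [_ /(_ Z)] := cT; case=> //.
  - by apply: subset_trans ZT (subsetDl _ _).
  - by apply: contraNneq aZ => ->.
  - by move=> f fT bf; apply/card_gt0P; exists f; rewrite inE fT bf dZ.
case: (pselect (conn ends Z)) => [cnZ|ncZ].
  exists Z; split=> //; apply: leq_trans le; exact: leq_pmull.
have [Y [YZ Y0 YnZ nY]] : exists Y, [/\ Y \subset Z, Y != set0, Y != Z &
    forall f, ins ends Z f -> ~~ bd ends Y f].
  apply: contrapT => H; apply: ncZ; split=> // Y YZ Y0 YnZ.
  apply: contrapT => H2; apply: H; exists Y; split=> // f fZ.
  by apply/negP => bf; apply: H2; exists f.
have dY := detached_sub ZT dZ YZ nY.
pose Y' := Z :\: Y.
have Y'Z : Y' \subset Z by exact: subsetDl.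
have Y'0 : Y' != set0 by apply: contra YnZ; rewrite setD_eq0 => ZY; rewrite eqEsubset YZ.
have nY' f : ins ends Z f -> ~~ bd ends Y' f.
  by move=> fZ; apply: contra (nY f fZ); case/andP: fZ => p q; rewrite /bd !inE p q; do 2 case: (_ \in Y).
have dY' := detached_sub ZT dZ Y'Z nY'.
have cYY' : #|Z| = #|Y| + #|Y'| by rewrite -(cardsID Y Z) (setIidPr YZ).
have pY : 0 < #|Y| by rewrite card_gt0.
have pY' : 0 < #|Y'| by rewrite card_gt0.
have lk : #|links Y| + #|links Y'| <= #|links Z|.
  rewrite -cardsUI (_ : _ :&: _ = set0) ?cards0 ?addn0.
    apply: subset_leq_card; apply/subsetP => f; rewrite !inE.
    have a1 : (ends f).1 == a -> (ends f).1 \notin Z by move=> /eqP ->.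
    have a2 : (ends f).2 == a -> (ends f).2 \notin Z by move=> /eqP ->.
    have y1 := subsetP YZ (ends f).1; have y2 := subsetP YZ (ends f).2.
    move: a1 a2 y1 y2; rewrite /bd !inE.
    by case: (ins _ _ _) => //=; do 2 case: (_ == a); do 2 case: (_ \in Y); do 2 case: (_ \in Z);
       move=> h1 h2 h3 h4; first [ by [] | by have := h1 isT | by have := h2 isT | by have := h3 isT | by have := h4 isT ].
  apply/setP => f; rewrite !inE.
    have a1 : (ends f).1 == a -> (ends f).1 \notin Z by move=> /eqP ->.
    have a2 : (ends f).2 == a -> (ends f).2 \notin Z by move=> /eqP ->.
    have y1 := subsetP YZ (ends f).1; have y2 := subsetP YZ (ends f).2.
    move: a1 a2 y1 y2; rewrite /bd !inE.
    by case: (ins _ _ _) => //=; do 2 case: (_ == a); do 2 case: (_ \in Y); do 2 case: (_ \in Z);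
       move=> h1 h2 h3 h4; first [ by [] | by have := h1 isT | by have := h2 isT | by have := h3 isT | by have := h4 isT ].
have lt1 : #|links Z| * s <= #|Y| + #|Y'| by rewrite -cYY'.
case: (leqP (#|links Y| * s) #|Y|) => lY.
  have ltY : #|Y| < n by clear -cZ cYY' pY'; lia.
  have [K [KY cK dK sK]] := IH Y ltY Y0 (subset_trans YZ ZT) dY lY.
  by exists K; split=> //; apply: subset_trans KY YZ.
have ltY' : #|Y'| < n by clear -cZ cYY' pY; lia.
have lY' : #|links Y'| * s <= #|Y'|.
  move: lY lt1; have : (#|links Y| + #|links Y'|) * s <= #|links Z| * s by rewrite leq_mul2r lk orbT.
  by rewrite mulnDl; clear; lia.
have [K [KY cK dK sK]] := IH Y' ltY' Y'0 (subset_trans Y'Z ZT) dY' lY'.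
by exists K; split=> //; apply: subset_trans KY Y'Z.
Qed.

Lemma conn_remove K : K \subset T :\ a -> detached K -> conn ends (T :\: K).
Proof.
move=> KT dK.
have aK : a \notin K by apply/negP => /(subsetP KT); rewrite !inE eqxx.
split; first by apply/set0Pn; exists a; rewrite inE aT aK.
have H W : W \subset T :\: K -> W != set0 -> a \notin W -> exists2 f, ins ends (T :\: K) f & bd ends W f.
  move=> WT W0 aW; have [_ /(_ W)] := cT; case=> //.
  - by apply: subset_trans WT (subsetDl _ _).
  - by apply: contraNneq aW => ->.
  move=> f fT bf; exists f => //.
  have w1 := subsetP WT (ends f).1; have w2 := subsetP WT (ends f).2.
  have nb : ~~ bd ends K f.
    apply/negP => bK; have := dK f fT bK; move: bf bK w1 w2; rewrite /bd !inE.
    case: eqP => [->|_]; case: eqP => [->|_] //=; rewrite (negbTE aW) (negbTE aK) /=.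
      by move=> -> -> _ /(_ isT).
    by rewrite !addbF => -> -> /(_ isT).
  move: bf nb w1 w2; rewrite /bd /ins !inE; case/andP: fT => -> ->.
  by do 2 case: (_ \in K); do 2 case: (_ \in W) => //=; move=> _ _ h1 h2;
     first [by [] | by have := h1 isT | by have := h2 isT].
move=> W WT W0 WnT; case: (boolP (a \in W)) => aW; last exact: H.
have [||f fT bf] := H ((T :\: K) :\: W) (subsetDl _ _).
- by apply: contra WnT; rewrite setD_eq0 => TW; rewrite eqEsubset WT.
- by rewrite inE aW.
exists f => //; move: bf; case/andP: fT => p q; rewrite /bd !(in_setD (T :\: K)) p q !andbT.
by do 2 case: (_ \in W).
Qed.

End Components.

Lemma star_outside T a f : bd ends [set a] f -> ~~ ins ends T f ->
  #|[set h | ins ends T h && bd ends [set a] h]| <= 2.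
Proof.
move=> bf nf; rewrite -ltnS -(cub a) [X in _ < X](cardsD1 f) inE bf add1n ltnS.
apply: subset_leq_card; apply/subsetP => h; rewrite !inE => /andP[hT ->].
by rewrite andbT; apply: contraNneq nf => <-.
Qed.

(** Deleting a vertex leaves at most three components, one of which has [s] vertices; so an
    admissible set exists. If a minimal one exceeded [2 * s], an end [a] of an edge leaving it would
    have at most two edges inside, and a component of the set minus [a] would be admissible: what
    remains of the set hangs on to the outside through [a]. *)
Lemma split_conn s U : 0 < s -> conn ends U -> 3 * s < #|U| ->
  exists T, [/\ T \subset U, conn ends T, conn ends (U :\: T), s <= #|T| & #|T| <= 2 * s].
Proof.
move=> s0 cU lU.
pose P T := `[< [/\ T \subset U, conn ends T, conn ends (U :\: T) & s <= #|T|] >].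
have links_le T a : #|links T a (T :\ a)| <= #|[set h | ins ends T h && bd ends [set a] h]|.
  by apply: subset_leq_card; apply/subsetP => h; rewrite !inE => /and3P[-> _ ->].
have det T a : a \in T -> detached T a (T :\ a).
  move=> aT f /andP[p q]; rewrite /bd !inE p q !andbT.
  by do 2 case: (_ == a).
have [T0 PT0] : exists T, P T.
  have [_ [a aU]] : True /\ exists a, a \in U by split=> //; apply/card_gt0P; clear -lU; lia.
  have cUa : #|U| = (#|U :\ a|).+1 by rewrite (cardsD1 a U) aU.
  have Ua0 : U :\ a != set0 by rewrite -card_gt0; clear -cUa lU s0; lia.
  have lk : #|links U a (U :\ a)| * s <= #|U :\ a|.
    apply: (@leq_trans (3 * s)); last by clear -cUa lU; lia.
    rewrite leq_mul2r; apply/orP; right; apply: leq_trans (links_le _ _) _.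
    by rewrite -(cub a); apply: subset_leq_card; apply/subsetP => h; rewrite !inE => /andP[].
  have [K [KU cK dK sK]] := big_component cU aU Ua0 (subxx _) (det U a aU) lk.
  exists K; apply/asboolP; split=> //.
  - by apply: subset_trans KU (subsetDl _ _).
  - exact: (conn_remove cU aU KU dK).
have [T [_ /asboolP [TU cT cUT sT] mT]] := minimal_set PT0.
exists T; split=> //; rewrite leqNgt; apply/negP => lT.
have TnU : T != U.
  by apply/eqP => TU'; case: cUT => /set0Pn [v]; rewrite TU' setDv inE.
have [_ /(_ T TU cT.1 TnU) [f fU bf]] := cU.
have [a [b [aT bT bU Jf]]] : exists a b, [/\ a \in T, b \notin T, b \in U & joined ends f a b].
  have J := joined_ends noloop f; move: bf; rewrite /bd.
  case/andP: fU => p q; case: (boolP ((ends f).1 \in T)) => pT /=.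
    by move=> qT; exists (ends f).1, (ends f).2.
  by move=> qT; exists (ends f).2, (ends f).1; split=> //; apply: joinedC.
have cTa : #|T| = (#|T :\ a|).+1 by rewrite (cardsD1 a T) aT.
have ab : a != b by case: Jf.
have fa : bd ends [set a] f by have [_ ->] := Jf; rewrite !inE eqxx eq_sym (negbTE ab).
have nf : ~~ ins ends T f by case: (joinedP Jf) => -[e1 e2]; rewrite /ins e1 e2 (negbTE bT) ?andbF.
have Ta0 : T :\ a != set0 by rewrite -card_gt0; clear -cTa lT s0; lia.
have lk : #|links T a (T :\ a)| * s <= #|T :\ a|.
  apply: (@leq_trans (2 * s)); last by clear -cTa lT; lia.
  by rewrite leq_mul2r (leq_trans (links_le _ _) (star_outside fa nf)) orbT.
have [K [KT cK dK sK]] := big_component cT aT Ta0 (subxx _) (det T a aT) lk.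
have KT' : K \subset T by apply: subset_trans KT (subsetDl _ _).
have : K = T.
  apply: mT => //; apply/asboolP; split=> //; first exact: subset_trans KT' TU.
  have -> : U :\: K = (T :\: K) :|: (U :\: T).
    apply/setP => v; rewrite !inE; have := subsetP KT' v; have := subsetP TU v.
    by case: (v \in K); case: (v \in T); case: (v \in U) => //= h1 h2;
      first [ by have := h1 isT | by have := h2 isT ].
  apply: (@conn_union _ _ f) => //; first exact: (conn_remove cT aT KT dK).
  exists a, b; split=> //; rewrite !inE ?aT ?bT ?bU ?andbT //.
  by apply/negP => /(subsetP KT); rewrite !inE eqxx.
by move=> KTe; have := subsetP KT a; rewrite KTe !inE eqxx aT => /(_ isT).
Qed.

(** Pieces of at most [2 * s] vertices are cut off only while more than [3 * s] are present, so the
    rest never falls below [s]. *)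
Lemma cluster_partition s U : 0 < s -> conn ends U -> s <= #|U| ->
  exists P : {set {set V}}, [/\ cover P = U, trivIset P &
    forall T, T \in P -> [/\ conn ends T, s <= #|T| & #|T| <= 3 * s]].
Proof.
move=> s0; have [n] := ubnP #|U|; elim: n U => // n IH U; rewrite ltnS => cn cU sU.
case: (leqP #|U| (3 * s)) => lU.
  exists [set U]; split; rewrite ?cover1 ?trivIset1 //.
  by move=> T; rewrite inE => /eqP ->.
have [T [TU cT cUT sT Ts]] := split_conn s0 cU lU.
have cD : #|U| = #|T| + #|U :\: T| by rewrite -(cardsID T U) (setIidPr TU).
have ltn' : #|U :\: T| < n by clear -cD cn sT s0; lia.
have sU' : s <= #|U :\: T| by clear -cD lU Ts; lia.
have [P [Pc Pt PP]] := IH _ ltn' cUT sU'.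
exists (T |: P); split.
- by rewrite /cover bigcup_setU big_set1 -/(cover P) Pc -{1}(setIidPr TU) setID.
- case: (@trivIsetU1 _ T P) => // [S SP|]; last by apply/negP => /PP [[]]; rewrite eqxx.
  rewrite disjoint_sym; have := bigcup_sup S SP : S \subset cover P.
  by rewrite Pc subsetD => /andP[].
- by move=> S; rewrite !inE => /orP[/eqP ->|/PP //]; split=> //; clear -Ts; lia.
Qed.

Hypothesis three_connected : forall U, U != set0 -> U != setT -> 3 <= #|[set f | bd ends U f]|.
Hypothesis cV : conn ends setT.

Definition crossing T T' := [set f | bd ends T f && bd ends T' f].

Lemma sum_crossing (R : {set {set V}}) T : trivIset R ->
  \sum_(T' in R) #|crossing T' T| <= 2 * #|[set f | bd ends T f]|.
Proof.
move=> tR.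
have once v : \sum_(T' in R) (v \in T') <= 1.
  case: (boolP (v \in cover R)) => [/bigcupP [A AR vA]|nv].
    rewrite (bigD1 A) //= vA big1 // => B /andP[BR BA]; apply/eqP; rewrite eqb0.
    have := (trivIsetP tR) A B AR BR; rewrite eq_sym => /(_ BA) dAB.
    by rewrite (disjointFr dAB vA).
  rewrite big1 // => B BR; apply/eqP; rewrite eqb0; apply: contra nv => vB.
  by apply/bigcupP; exists B.
rewrite (eq_bigr (fun T' => \sum_(f | bd ends T f) bd ends T' f)); last first.
  move=> T' _; rewrite -sum1_card big_mkcond [RHS]big_mkcond /=; apply: eq_bigr => f _.
  by rewrite /crossing inE; case: (bd ends T f); case: (bd ends T' f).
rewrite exchange_big /= -sum1_card big_distrr /= [leqRHS](eq_bigl (fun f => bd ends T f)); last first.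
  by move=> f; rewrite inE.
apply: leq_sum => f _; apply: leq_trans (_ : \sum_(T' in R) (((ends f).1 \in T') + ((ends f).2 \in T')) <= _).
  by apply: leq_sum => T' _; rewrite /bd; do 2 case: (_ \in T').
by rewrite big_split /=; apply: (leq_add (once _) (once _)).
Qed.

Lemma boundary_crossing (P : {set {set V}}) T : cover P = setT -> trivIset P -> T \in P ->
  #|[set f | bd ends T f]| <= \sum_(T' in P | T' != T) #|crossing T' T|.
Proof.
move=> cP tP TP.
rewrite (eq_bigr (fun T' => \sum_(f | bd ends T f) bd ends T' f)); last first.
  move=> T' _; rewrite -sum1_card big_mkcond [RHS]big_mkcond /=; apply: eq_bigr => f _.
  by rewrite /crossing inE; case: (bd ends T f); case: (bd ends T' f).
rewrite exchange_big /= -sum1_card [leqLHS](eq_bigl (fun f => bd ends T f)); last first.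
  by move=> f; rewrite inE.
apply: leq_sum => f bf.
have [a [b [aT bT Jf]]] : exists a b, [/\ a \in T, b \notin T & joined ends f a b].
  have J := joined_ends noloop f; move: bf; rewrite /bd.
  case: (boolP ((ends f).1 \in T)) => pT /=.
    by move=> qT; exists (ends f).1, (ends f).2.
  by move=> qT; exists (ends f).2, (ends f).1; split=> //; apply: joinedC.
have /bigcupP [B BP bB] : b \in cover P by rewrite cP.
have BT : B != T by apply: contraNneq bT => <-.
rewrite (bigD1 B) /=; last by rewrite BP BT.
have [_ ->] := Jf; rewrite bB.
have dTB := (trivIsetP tP) B T BP TP BT.
by rewrite (disjointFl dTB aT).
Qed.

(** Without a gadget outside [Q], the boundaries there total at most [36 * (s * J)] towards [Q]
    (boundaries of at most [9 * s], each edge counted at most twice) plus [4 * (#|P| * #|P|)] among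
    themselves. With the [6 * (s * J)] vertices of [Q], sparsity gives [#|V| <= 546 * (s * J) + 60 *
    (#|P| * #|P|)]. The last term is at most half of [#|V|] since [#|P| * s <= #|V|], and
    [1092 = 2 * 546]. *)
Lemma next_gadget s J (P Q : {set {set V}}) : 120 * #|V| < s * s ->
  1092 * s * J.+1 <= #|V| -> cover P = setT -> trivIset P ->
  (forall T, T \in P -> [/\ conn ends T, s <= #|T| & #|T| <= 3 * s]) ->
  Q \subset P -> #|Q| <= 2 * J ->
  (exists T, [/\ T \in P :\: Q & gadget ends T]) \/
  (exists T T', [/\ T \in P :\: Q, T' \in P :\: Q, T != T' & gadget ends (T :|: T')]).
Proof.
move=> sV sJ cP tP PP QP cQ.
apply: contrapT => /not_orP [nd np].
pose R := P :\: Q.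
have s0 : 0 < s by case: (s) sV => //; rewrite muln0.
have V0 : 0 < #|V| by move: sJ; case: #|V| => //; rewrite leqn0 muln_eq0 muln_eq0 /= orbF; lia.
have TT T : T \in P -> T != set0 /\ T != setT.
  move=> /PP [[T0 _] _ Ts]; split=> //; apply/eqP => TV.
  have : #|V| <= 3 * s by rewrite -cardsT -TV.
  have : 1092 * s <= #|V| by apply: leq_trans sJ; rewrite leq_pmulr.
  by lia.
(* If [15 * b < #|T|] for the boundary size [b], then [3 * #|T| = 2 * i + b] yields
   [44 * #|T| < 30 * i] for the number [i] of inner edges. *)
have sparse T : T \in R -> #|T| <= 15 * #|[set f | bd ends T f]|.
  move=> TR; have TP : T \in P by move: TR; rewrite inE => /andP[].
  have [T0 T1] := TT T TP.
  have eT := card_degrees noloop cub T.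
  rewrite leqNgt; apply/negP => lt; apply: nd; exists T; split=> //.
  by apply: (dense_gadget noloop cub three_connected) => //; lia.
have few T T' : T \in R -> T' \in R -> T' != T -> #|crossing T' T| <= 4.
  move=> TR T'R T'T; rewrite leqNgt; apply/negP => c5; apply: np; exists T', T; split=> //.
  have TP : T \in P by move: TR; rewrite inE => /andP[].
  have T'P : T' \in P by move: T'R; rewrite inE => /andP[].
  have [cT _ _] := PP T TP; have [cT' _ _] := PP T' T'P.
  apply: (pair_gadget noloop cub cT' cT) => //.
  exact: (trivIsetP tP) T' T T'P TP T'T.
have cPs : \sum_(T in P) #|T| = #|V| by rewrite (eqP tP) cP cardsT.
have cPQ : \sum_(T in P) #|T| = \sum_(T in Q) #|T| + \sum_(T in R) #|T|.
  rewrite (bigID (mem Q)) /=; congr (_ + _); apply: eq_bigl => T.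
    by case: (boolP (T \in Q)) => TQ; rewrite ?andbF // andbT (subsetP QP).
  by rewrite /R in_setD andbC.
have cQs : \sum_(T in Q) #|T| <= 6 * (s * J).
  apply: (@leq_trans (\sum_(T in Q) (3 * s))).
    by apply: leq_sum => T /(subsetP QP) /PP [].
  rewrite sum_nat_const; have : #|Q| * (3 * s) <= 2 * J * (3 * s) by rewrite leq_mul2r cQ orbT.
  by lia.
have bQ : \sum_(T in R) \sum_(T' in Q) #|crossing T' T| <= 36 * (s * J).
  rewrite exchange_big /=.
  apply: (@leq_trans (\sum_(T' in Q) (18 * s))).
    apply: leq_sum => T' T'Q; rewrite (eq_bigr (fun T => #|crossing T T'|)); last first.
      by move=> T _; apply: eq_card => f; rewrite /crossing !inE andbC.
    apply: leq_trans (sum_crossing T' (trivIsetD _ tP)) _.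
    have [_ _ Ts] := PP T' (subsetP QP _ T'Q); have := card_degrees noloop cub T'; lia.
  rewrite sum_nat_const; have : #|Q| * (18 * s) <= 2 * J * (18 * s) by rewrite leq_mul2r cQ orbT.
  by lia.
have bR : \sum_(T in R) \sum_(T' in R | T' != T) #|crossing T' T| <= 4 * (#|P| * #|P|).
  apply: (@leq_trans (\sum_(T in R) (4 * #|P|))).
    apply: leq_sum => T TR; apply: (@leq_trans (\sum_(T' in P) 4)).
      rewrite big_mkcond [leqRHS]big_mkcond /=; apply: leq_sum => T' _.
      case: ifP => [/andP[T'R T'T]|] //.
      by have := T'R; rewrite inE => /andP[_ ->]; apply: few.
    by rewrite sum_nat_const mulnC.
  rewrite sum_nat_const; have RP : #|R| <= #|P| by apply: subset_leq_card; apply: subsetDl.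
  have : #|R| * (4 * #|P|) <= #|P| * (4 * #|P|) by rewrite leq_mul2r RP orbT.
  by lia.
have bd_le : \sum_(T in R) #|[set f | bd ends T f]| <= 36 * (s * J) + 4 * (#|P| * #|P|).
  apply: leq_trans (leq_add bQ bR); rewrite -big_split /=; apply: leq_sum => T TR.
  have TP : T \in P by move: TR; rewrite inE => /andP[].
  apply: leq_trans (boundary_crossing cP tP TP) _.
  rewrite (bigID (mem Q)) /=; apply: leq_add.
    rewrite big_mkcond [leqRHS]big_mkcond /=; apply: leq_sum => T' _.
    by case: (T' \in P); case: (T' \in Q); case: (T' != T).
  rewrite leq_eqVlt; apply/orP; left; apply/eqP; apply: eq_bigl => T'.
  by rewrite /R in_setD; case: (T' \in P); case: (T' \in Q); case: (T' != T).
have sumR : \sum_(T in R) #|T| <= 15 * \sum_(T in R) #|[set f | bd ends T f]|.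
  by rewrite big_distrr /=; apply: leq_sum => T; apply: sparse.
have Ps : #|P| * s <= #|V|.
  by rewrite -cPs -sum_nat_const; apply: leq_sum => T /PP [].
have P2 : 120 * (#|P| * #|P|) <= #|V|.
  rewrite -(leq_pmul2r V0); apply: (@leq_trans ((#|P| * s) * (#|P| * s))); last exact: leq_mul.
  rewrite [leqLHS](_ : _ = (#|P| * #|P|) * (120 * #|V|)); last by clear; lia.
  rewrite [leqRHS](_ : _ = (#|P| * #|P|) * (s * s)); last by clear; lia.
  by rewrite leq_mul2l (ltnW sV) orbT.
move: cPQ; rewrite cPs => cPQ; clear -cPQ cQs sumR bd_le P2 sJ s0.
have : 1092 * s * J.+1 = 1092 * (s * J) + 1092 * s by lia.
lia.
Qed.

Lemma many_gadgets s J : 120 * #|V| < s * s -> 1092 * s * J <= #|V| -> 0 < s ->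
  exists G : {set {set V}}, [/\ #|G| = J, trivIset G & forall U, U \in G -> gadget ends U].
Proof.
move=> sV sJ s0.
have [J0|J0] := posnP J.
  exists set0; rewrite cards0 J0; split=> //; last by move=> U; rewrite inE.
  by rewrite /trivIset /cover !big_set0 cards0.
have [|P [cP tP PP]] := cluster_partition s0 cV.
  by rewrite cardsT; apply: leq_trans sJ; rewrite -mulnA mulnCA leq_pmulr // muln_gt0.
(* [Q] collects the clusters used up, at most two per gadget; clusters outside it are disjoint from
   all gadgets found so far. *)
suff H j : j <= J -> exists G Q : {set {set V}}, [/\ #|G| = j, trivIset G,
    forall U, U \in G -> U != set0 /\ gadget ends U & [/\ Q \subset P, #|Q| <= 2 * j & cover G = cover Q]].
  have [G [Q [cG tG GG _]]] := H J (leqnn J).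
  by exists G; split=> // U /GG [].
elim: j => [_|j IH jJ].
  exists set0, set0; rewrite cards0; split=> //; [|by move=> U; rewrite inE|].
    by rewrite /trivIset /cover !big_set0 cards0.
  by rewrite sub0set.
have [G [Q [cG tG GG [QP cQ GQ]]]] := IH (ltnW jJ).
have out T : T \in P :\: Q -> [/\ T \in P, T \notin Q, T != set0 & [disjoint T & cover Q]].
  rewrite inE => /andP[TQ TP]; have [[T0 _] _ _] := PP T TP; split=> //.
  apply/bigcup_disjointP => B BQ.
  apply: (trivIsetP tP) => //; first exact: (subsetP QP).
  by apply: contraNneq TQ => ->.
have add U (Q' : {set {set V}}) : U != set0 -> [disjoint U & cover Q] -> gadget ends U -> Q' \subset P ->
    #|Q'| <= 2 -> cover Q' = U -> exists G Q : {set {set V}}, [/\ #|G| = j.+1, trivIset G,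
    forall U, U \in G -> U != set0 /\ gadget ends U &
    [/\ Q \subset P, #|Q| <= 2 * j.+1 & cover G = cover Q]].
  move=> U0 dU gU Q'P cQ' Q'U; exists (U |: G), (Q' :|: Q).
  have [||tUG UG] := @trivIsetU1 _ U G _ tG.
  - move=> B BG; rewrite disjoint_sym; apply: disjointWl (_ : B \subset cover Q) _.
      by rewrite -GQ; apply: bigcup_sup.
    by rewrite disjoint_sym.
  - by apply/negP => /GG []; rewrite eqxx.
  split=> //.
  - by rewrite cardsU1 UG cG.
  - by move=> W; rewrite !inE => /orP[/eqP ->|/GG].
  split.
  - by rewrite subUset Q'P QP.
  - by apply: leq_trans (leq_card_setU _ _).1 _; clear -cQ cQ'; lia.
  - by rewrite /cover !bigcup_setU big_set1 -!/(cover _) GQ Q'U.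
have sJ' : 1092 * s * j.+1 <= #|V| by apply: leq_trans sJ; rewrite leq_mul2l jJ orbT.
case: (next_gadget sV sJ' cP tP PP QP cQ) => [[T [/out [TP _ T0 dT] gT]]|].
  apply: (add T [set T]) => //; first by rewrite sub1set.
    by rewrite cards1.
  by rewrite cover1.
move=> [T [T' [/out [TP _ T0 dT] /out [T'P _ T'0 dT'] TT' gT]]].
apply: (add (T :|: T') [set T; T']) => //.
- by apply: contra T0; rewrite setU_eq0 => /andP[].
- by rewrite -setI_eq0 setIUl setU_eq0 !setI_eq0 dT dT'.
- by rewrite subUset !sub1set TP T'P.
- by rewrite cards2; case: (_ != _).
- by rewrite /cover bigcup_setU !big_set1.
Qed.

End Clusters.


(** * Counting *)

(* Stated with variables: the numerals of the instance must not be unfolded. *)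
Lemma power_compare k N p q r t a b c x z : 0 < k -> 0 < t ->
  p ^ (a * k) * (q ^ (b * k) * r ^ (c * k)) <= N * t ^ (a * k) ->
  x * t ^ a <= z * (p ^ a * (q ^ b * r ^ c)) -> x ^ k <= N * z ^ k.
Proof.
move=> k0 t0 W num; rewrite -(@leq_pmul2r (t ^ (a * k))) ?expn_gt0 ?t0 //.
rewrite mulnAC; apply: leq_trans (leq_mul W (leqnn (z ^ k))).
by rewrite !expnM -!expnMn leq_exp2r // [leqRHS]mulnC.
Qed.

Section Counting.
Variables (V E : finType) (ends : E -> V * V).
Hypothesis noloop : loopless ends.
Hypothesis cubG : cubic ends.
Hypothesis cyc4 : cyclically_k_edge_connected ends 4.
Variables (e : E) (K : nat).

Lemma perfect_matchingP (M : {set E}) :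
  (forall v, #|[set f in M | bd ends [set v] f]| = 1) -> perfect_matching ends M.
Proof.
move=> H; apply/forallP => v; rewrite -(H v); apply/eqP/eq_card => f.
by rewrite !inE incidentE.
Qed.

Lemma perfect_matching_card (M : {set E}) v : perfect_matching ends M ->
  #|[set f in M | bd ends [set v] f]| = 1.
Proof.
move=> /forallP /(_ v) /eqP <-; apply: eq_card => f.
by rewrite !inE incidentE.
Qed.

Section Weights.
Local Open Scope ring_scope.
Variables (I : finType) (U : I -> {set V}) (w : I -> V) (y : I -> E -> E -> rat).
Hypothesis cI : #|I| = (45 * K)%N.
Hypothesis K0 : (0 < K)%N.
Hypothesis Udis : forall i j h, i != j -> ins ends (U i) h -> ins ends (U j) h -> False.
Hypothesis Ue : forall i, ~~ ins ends (U i) e.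
Hypothesis yP : forall i f, bd ends [set w i] f ->
  [/\ forall h, ~~ ins ends (U i) h -> y i f h = 0,
      forall v, \sum_(h | bd ends [set v] h) y i f h = 0, boxed (y i f) & y i f f = -1].

(** The factor 45 turns the bound [J / 5 + J / 9] into the integer [14 * K]. *)
Lemma matching_few_hits (s : I -> E) : (forall i, bd ends [set w i] (s i)) ->
  exists2 M, perfect_matching ends M && (e \notin M) & (#|[set i | s i \in M]| <= 14 * K)%N.
Proof.
move=> sw.
pose x f : rat := 1 / 3 + 2 / 15 * \sum_i y i (s i) f.
have others i f : ins ends (U i) f -> \sum_j y j (s j) f = y i (s i) f.
  move=> fU; rewrite (bigD1 i) //= big1 ?addr0 // => j ji.
  have [y0 _ _ _] := yP (sw j); apply: y0; apply/negP => fj; exact: (Udis ji fj fU).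
have ysum f : -1 <= \sum_i y i (s i) f <= 1.
  case: (pselect (exists i, ins ends (U i) f)) => [[i fi]|nf].
    by rewrite (others i) //; have [_ _ yb _] := yP (sw i).
  rewrite big1 ?lerN10 ?ler01 // => i _; have [y0 _ _ _] := yP (sw i).
  by apply: y0; apply/negP => fi; apply: nf; exists i.
have x5 f : 1 / 5 <= x f by have := ysum f; rewrite /x; lra.
have xv v : \sum_(f | bd ends [set v] f) x f = 1.
  rewrite big_split /= [X in _ + X](_ : _ = 0) ?addr0; last first.
    rewrite -mulr_sumr exchange_big /= big1 ?mulr0 // => i _.
    by have [_ -> _ _] := yP (sw i).
  rewrite sumr_const (_ : #|_| = 3%N); first by rewrite -mulr_natr; lra.
  by rewrite -(cubic_star noloop cubG v); apply: eq_card => f; rewrite !inE.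
have xP : fractional_pm ends x.
  split; [| |exact: xv|].
  - by move=> f; apply: le_trans (x5 f); rewrite divr_ge0.
  - by move=> f ef; have := noloop f; rewrite ef eqxx.
  - move=> X oX; case: (leqP #|X| 1) => cX.
      have /cards1P [v ->] : #|X| == 1%N by case: #|X| oX cX => [|[]].
      by rewrite xv.
    have oX' : odd #|~: X|.
      by have := order_even_cubic noloop cubG; rewrite -(cardsC X) oddD oX; case: (odd _).
    case: (leqP #|~: X| 1) => cX'.
      have /cards1P [v vE] : #|~: X| == 1%N by case: #|~: X| oX' cX' => [|[]].
      by rewrite (eq_bigl (bd ends [set v])) ?xv // => f; rewrite -vE bdC.
    have b5 := boundary_ge5 noloop cubG cyc4 oX cX cX'.
    apply: (@le_trans _ _ (\sum_(f | bd ends X f) (1 / 5))); last by apply: ler_sum.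
    rewrite sumr_const -mulr_natr (_ : #|_| = #|[set f | bd ends X f]|); last first.
      by apply: eq_card => f; rewrite !inE.
    have : 5%:R <= (#|[set f | bd ends X f]|)%:R :> rat by rewrite ler_nat.
    lra.
pose J : rat := (#|I|)%:R.
(* Negated, because domination bounds the cost of the matching from below. *)
pose c f : rat := - (\sum_i (s i == f)%:R) - J / 3 * (f == e)%:R.
have [M [_ Mv cM]] := edmonds xP c.
have sumc (F : E -> rat) (P : pred E) : \sum_(f | P f) c f * F f =
    - (\sum_i (P (s i))%:R * F (s i)) - J / 3 * ((P e)%:R * F e).
  rewrite (eq_bigr (fun f => - (\sum_i (s i == f)%:R * F f) - J / 3 * ((f == e)%:R * F f))); last first.
    by move=> f _; rewrite /c mulrBl mulNr mulr_suml mulrA.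
  rewrite sumrB sumrN -mulr_sumr exchange_big /=.
  have pick u : \sum_(f | P f) (u == f)%:R * F f = (P u)%:R * F u.
    rewrite big_mkcond (bigD1 u) //= big1 ?addr0 ?eqxx ?mul1r.
      by case: (P u); rewrite ?mul1r ?mul0r.
    by move=> f /negbTE; rewrite eq_sym => ->; rewrite mul0r if_same.
  congr (- _ - _ * _); first by apply: eq_bigr.
  by rewrite -pick; apply: eq_bigr => f _; rewrite eq_sym.
have xs i : x (s i) = 1 / 5.
  have [y0 _ _ yi] := yP (sw i).
  have iU : ins ends (U i) (s i).
    by apply/negPn/negP => /y0; rewrite yi => /eqP; rewrite oppr_eq0 oner_eq0.
  rewrite /x (others i) // yi; lra.
have xe : x e = 1 / 3.
  rewrite /x big1 ?mulr0 ?addr0 // => i _.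
  by have [y0 _ _ _] := yP (sw i); apply: y0.
pose h : rat := (#|[set i | s i \in M]|)%:R.
have J0 : 0 < J by rewrite /J ltr0n cI; lia.
have hM : h + J / 3 * (e \in M)%:R <= J / 5 + J / 9.
  move: cM; rewrite (sumc x predT) /= xe.
  rewrite [X in _ <= X](eq_bigr (fun f => c f * 1)) => [|f _]; last by rewrite mulr1.
  rewrite (sumc (fun=> 1) (mem M)) /= mulr1.
  have -> : \sum_i 1 * x (s i) = J / 5.
    rewrite (eq_bigr (fun=> 1 / 5)) => [|i _]; last by rewrite xs mul1r.
    have -> : \sum_(i : I) (1 / 5 : rat) = 1 / 5 *+ #|I| by rewrite -sumr_const; apply: eq_bigl.
    by rewrite -mulr_natr -/J mulrC mul1r.
  have -> : \sum_i (s i \in M)%:R * 1 = h.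
    rewrite /h -sum1_card natr_sum [RHS]big_mkcond /=; apply: eq_bigr => i _.
    by rewrite inE mulr1; case: (_ \in M).
  lra.
have eM : e \notin M.
  apply/negP => eM; move: hM; rewrite eM /=.
  have : 0 <= h by rewrite /h ler0n.
  lra.
exists M; first by rewrite eM andbT perfect_matchingP.
rewrite -(ler_nat rat) -/h; move: hM; rewrite (negbTE eM) /= /J cI !natrM; lra.
Qed.

Local Open Scope nat_scope.

(* Chernoff bound: a fixed matching contains exactly one edge at each [w i], so
   it carries total weight [(9 + 10 + 10) ^ #|I|] over all choices [s], whereas
   it covers [s] only if the weight of [s] is large. *)
Lemma weighted_count :
  3 ^ (45 * K) * (9 ^ (14 * K) * 10 ^ (31 * K)) <= num_pm_avoiding ends e * 29 ^ (45 * K).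
Proof.
have prod_cond (p : pred I) n : \prod_(i | p i) n = n ^ #|[set i | p i]|.
  by rewrite prod_nat_const cardsE.
pose Q i f := bd ends [set w i] f.
pose PM := [set M | perfect_matching ends M && (e \notin M)].
(* The ratio 9/10 is close to 28/31, the optimal Chernoff tilt for a hit frequency of 14/45 where
   the mean is 1/3. *)
pose wt (M : {set E}) (s : {ffun I -> E}) := \prod_i (if s i \in M then 9 else 10).
have cQ i : #|[set f | Q i f]| = 3 by exact: cubic_star.
have cF : \sum_(s in family Q) 1 = 3 ^ (45 * K).
  rewrite (eq_bigr (fun s : {ffun I -> E} => \prod_(i : I) 1)) => [|s _]; last by rewrite big1.
  rewrite -(bigA_distr_big_dep Q (fun=> fun=> 1)) /= (eq_bigr (fun=> 3)) => [|i _].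
    by rewrite -cI -prod_nat_const; apply: eq_bigl.
  by rewrite -(cQ i) -sum1_card; apply: eq_bigl => f; rewrite inE.
have sumM M : M \in PM -> \sum_(s in family Q) wt M s = 29 ^ (45 * K).
  rewrite inE => /andP[pM _].
  rewrite -(bigA_distr_big_dep Q (fun=> fun f => if f \in M then 9 else 10)) /=.
  rewrite (eq_bigr (fun=> 29)) => [|i _]; first by rewrite -cI -prod_nat_const; apply: eq_bigl.
  rewrite (bigID (mem M)) /= (eq_bigr (fun=> 9)) => [|f /andP[_ ->]] //.
  rewrite [X in _ + X](eq_bigr (fun=> 10)) => [|f /andP[_ /negbTE ->]] //.
  rewrite !sum_nat_cond_const.
  have c1 := perfect_matching_card (w i) pM.
  have : #|[set f | Q i f]| = #|[set f in M | bd ends [set w i] f]| + #|[set f | Q i f && (f \notin M)]|.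
    rewrite -[LHS](cardsID M); congr (_ + _); apply: eq_card => f; rewrite !inE andbC //.
  rewrite cQ c1 => c2.
  have -> : #|[set f | Q i f & f \in M]| = 1.
    by rewrite -c1; apply: eq_card => f; rewrite !inE andbC.
  by have -> : #|[set f | Q i f & f \notin M]| = 2 by move: c2; lia.
have big_wt s : s \in family Q -> 9 ^ (14 * K) * 10 ^ (31 * K) <= \sum_(M in PM) wt M s.
  move=> /familyP sQ; have [M MP hits] := matching_few_hits sQ.
  rewrite (bigD1 M) /=; last by rewrite inE.
  apply: leq_trans (leq_addr _ _); rewrite /wt (bigID (fun i => s i \in M)) /=.
  rewrite (eq_bigr (fun=> 9)) => [|i ->] //.
  rewrite [X in _ <= _ * X](eq_bigr (fun=> 10)) => [|i /negbTE ->] //.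
  rewrite !prod_cond.
  set h := #|[set i | s i \in M]| in hits *.
  have c2 : h + #|[set i | s i \notin M]| = 45 * K.
    rewrite -cI -(cardsC [set i | s i \in M]) /h; congr (_ + _).
    by apply: eq_card => i; rewrite !inE.
  have -> : #|[set i | s i \notin M]| = (14 * K - h) + 31 * K by clear -c2 hits; lia.
  rewrite expnD mulnA leq_mul2r; apply/orP; right.
  rewrite -{1}(subnKC hits) expnD leq_mul2l; apply/orP; right.
  by case: (14 * K - h) => // k; rewrite leq_exp2r.
have -> : num_pm_avoiding ends e = #|PM| by [].
rewrite -cF big_distrl /= -sum_nat_const.
apply: (@leq_trans (\sum_(s in family Q) \sum_(M in PM) wt M s)).
  by apply: leq_sum => s sQ; rewrite mul1n; apply: big_wt.
by rewrite exchange_big /=; apply: leq_sum => M /sumM ->.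
Qed.

End Weights.

Lemma exponential_count (G : {set {set V}}) : 0 < K -> #|G| = (45 * K).+1 -> trivIset G ->
  (forall U, U \in G -> gadget ends U) -> 21 ^ K <= num_pm_avoiding ends e * 20 ^ K.
Proof.
move=> K0 cG tG GG.
have Gdis U W h : U \in G -> W \in G -> ins ends U h -> ins ends W h -> U = W.
  move=> UG WG /andP[hU _] /andP[hW _]; apply/eqP/negPn/negP => UW.
  by have := disjointFr (trivIsetP tG U W UG WG UW) hU; rewrite hW.
have [G' [G'G cG' eG']] : exists G' : {set {set V}}, [/\ G' \subset G, #|G'| = 45 * K &
    forall U, U \in G' -> ~~ ins ends U e].
  (* The spare gadget in [(45 * K).+1]: the one around [e], or an arbitrary one if [e] lies in
     none. *)
  have [U0 [U0G eU0]] : exists U0, U0 \in G /\ forall U, U \in G -> ins ends U e -> U = U0.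
    case: (pselect (exists2 U, U \in G & ins ends U e)) => [[U UG eU]|nU].
      by exists U; split=> // W WG eW; apply: Gdis WG UG eW eU.
    have /card_gt0P [U UG] : 0 < #|G| by rewrite cG.
    by exists U; split=> // W WG eW; case: nU; exists W.
  exists (G :\ U0); split; first exact: subsetDl.
    by move: cG; rewrite (cardsD1 U0) U0G add1n => -[].
  by move=> U; rewrite !inE => /andP[UU0 UG]; apply: contra UU0 => /(eU0 _ UG) ->.
pose I := {U : {set V} | U \in G'}.
have H (i : I) : exists wy : V * (E -> E -> rat), forall f, bd ends [set wy.1] f ->
  [/\ forall h, ~~ ins ends (val i) h -> wy.2 f h = 0%R,
      forall v, (\sum_(h | bd ends [set v] h) wy.2 f h = 0)%R, boxed (wy.2 f) &
      wy.2 f f = (-1)%R].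
  have [w wP] := GG _ (subsetP G'G _ (valP i)).
  have H f : exists y : E -> rat, bd ends [set w] f ->
    [/\ forall h, ~~ ins ends (val i) h -> y h = 0%R,
      forall v, (\sum_(h | bd ends [set v] h) y h = 0)%R, boxed y & y f = (-1)%R].
    by case: (boolP (bd ends [set w] f)) => [/wP [y yP]|_]; [exists y|exists (fun=> 0%R)].
  by have [y yP] := choice H; exists (w, y).
have [wy wyP] := choice H.
have cI : #|{: I}| = 45 * K by rewrite card_sig -cG'; apply: eq_card => U.
have W := @weighted_count I (fun i => val i) (fun i => (wy i).1) (fun i => (wy i).2) cI K0 _ _ wyP.
have {}W : 3 ^ (45 * K) * (9 ^ (14 * K) * 10 ^ (31 * K)) <= num_pm_avoiding ends e * 29 ^ (45 * K).
  apply: W.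
    move=> i j h ij hi hj; move: ij; rewrite -(inj_eq val_inj) => /eqP; apply.
    by apply: Gdis hi hj; apply: (subsetP G'G); apply: valP.
  by move=> i; apply: eG'; apply: valP.
(* Equivalently [(30 / 29) ^ 45 * (9 / 10) ^ 14 >= 21 / 20], the gain per unit of [K]. *)
have num : 21 * 29 ^ 45 <= 20 * (3 ^ 45 * (9 ^ 14 * 10 ^ 31)) by lia.
exact: power_compare K0 _ W num.
Qed.

End Counting.


(** * An exponential in the square root of the order *)

Lemma growth : exists c, forall (V E : finType) (ends : E -> V * V) (e : E),
  loopless ends -> cubic ends -> cyclically_k_edge_connected ends 4 ->
  exists K, #|V| < (c * K.+1) ^ 2 /\
    (K = 0 \/ 21 ^ K <= num_pm_avoiding ends e * 20 ^ K).
Proof.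
(* With [m] the integer square root of the order and clusters of size [20 * m.+1], the bounds
   [m.+1 <= 2 * m] and [45 * K + 1 <= 46 * K] produce the factor [92 = 2 * 46]. *)
set c := 92 * (20 * 1092); exists c => V E ends e noloop cubG cyc4.
have [m [m1 m2]] : exists m, m ^ 2 <= #|V| /\ #|V| < m.+1 ^ 2.
  elim: #|V| => [|n [m [h1 h2]]]; first by exists 0.
  case: (leqP (m.+1 ^ 2) n.+1) => h; last by exists m; split=> //; apply: leq_trans h1 (leqnSn n).
  have h3 : m.+1 ^ 2 < m.+2 ^ 2 by rewrite ltn_exp2r.
  by exists m.+1; split=> //; apply: leq_ltn_trans h2 h3.
exists (m %/ c); split.
  apply: leq_trans m2 _; rewrite leq_exp2r // mulnC; exact: ltn_ceil.
case: (posnP (m %/ c)) => [->|K0]; [by left|right].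
set K := m %/ c in K0 *.
have Km : K * c <= m by exact: leq_divM.
have cm : c <= m by rewrite -divn_gt0.
have [|||G [cG tG GG]] := @many_gadgets V E ends noloop (cubic_star noloop cubG)
    (boundary_ge3 noloop cubG cyc4) (conn_setT noloop cubG cyc4 (ends e).1)
    (20 * m.+1) (45 * K).+1.
- move: m2; rewrite !expnS expn0 muln1; clear; lia.
- apply: leq_trans m1; rewrite expnS expn1.
  have : c * (m * K) <= m * m by rewrite mulnCA leq_mul2l mulnC Km orbT.
  have : m <= m * K by rewrite leq_pmulr.
  have : 1 <= m by apply: leq_trans cm.
  rewrite /c in Km cm; clear -K0; nia.
- by rewrite muln_gt0.
exact: (@exponential_count V E ends noloop cubG cyc4 e K G K0 cG tG GG).
Qed.

Lemma quarter_bounds k : k.+1 <= 4 * (k %/ 4).+1 /\ k %/ 4 * 4 <= k.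
Proof. by split; [rewrite mulnC; apply: ltn_ceil|apply: leq_divM]. Qed.

(* Comparison with a linear function over the reals *)
From Stdlib Require Import Reals Lra.
Open Scope R_scope.

Lemma INR_expn (a k : nat) : INR (expn a k) = (INR a ^ k)%R.
Proof.
elim: k => [|k IH]; first by rewrite expn0.
by rewrite expnS -multE mult_INR IH.
Qed.

Lemma INR_le (m n : nat) : leq m n -> INR m <= INR n.
Proof. by move=> /ssrnat.leP; apply: le_INR. Qed.

(* [u^2/160000 - 16 A u + 10240000 A^2] is the square of [u/400 - 3200 A]. *)
Lemma quadratic_below_exponential (A : R) (k : nat) : 0 < A ->
  A * (INR k + 1) ^ 2 - 10240000 * A ^ 2 <= (21 / 20) ^ k.
Proof.
move=> A0.
have [] := quarter_bounds k; set l := divn k 4 => kl0 lk.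
have kl : INR k + 1 <= 4 * (INR l + 1).
  by have := INR_le kl0; rewrite -multE mult_INR !S_INR /=; Lra.lra.
have k0 : 0 <= INR k by apply: pos_INR.
have l0 : 0 <= INR l by apply: pos_INR.
have pw : ((21 / 20) ^ l) ^ 4 <= (21 / 20) ^ k.
  rewrite -pow_mult; apply: Rle_pow; first by Lra.lra.
  by apply/ssrnat.leP; rewrite multE.
(* Bernoulli's inequality for a quarter of the exponent: its fourth power has degree four and so
   beats the square. *)
have bern : (INR l + 1) / 20 <= (21 / 20) ^ l.
  have := poly l (1 / 20); have -> : 1 + 1 / 20 = 21 / 20 by field.
  have p : 0 < 1 / 20 by Lra.lra.
  by move=> /(_ p) h; Lra.lra.
set t := (INR l + 1) in kl bern.
have t1 : 1 <= t by rewrite /t; Lra.lra.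
have bern4 : (t / 20) ^ 4 <= ((21 / 20) ^ l) ^ 4.
  by apply: pow_incr; split=> //; Lra.lra.
have sq : A * (INR k + 1) ^ 2 <= 16 * A * t ^ 2.
  have : (INR k + 1) ^ 2 <= (4 * t) ^ 2 by apply: pow_incr; Lra.lra.
  by move=> /(Rmult_le_compat_l A _ _ (Rlt_le _ _ A0)); rewrite Rpow_mult_distr; Lra.lra.
have := pow2_ge_0 (t ^ 2 / 400 - 3200 * A); Lra.nra.
Qed.

Theorem mainTheorem2 :
  forall alpha : R, 0 < alpha ->
  exists beta : R, 0 < beta /\
    forall (V E : finType) (ends : E -> V * V),
      loopless ends -> cubic ends -> cyclically_k_edge_connected ends 4 ->
      forall e : E,
        alpha * INR #|V| - beta <= INR (num_pm_avoiding ends e).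
Proof.
move=> alpha a0; have [c grow] := growth; pose C : R := INR c ^ 2 + 1.
have C0 : 0 < C by have := pow2_ge_0 (INR c); rewrite /C; Lra.lra.
have aC : 0 < alpha * C by apply: Rmult_lt_0_compat.
(* The first summand is the loss in [quadratic_below_exponential]; the second covers [K = 0], where
   the order is bounded. *)
exists (10240000 * (alpha * C) ^ 2 + alpha * C); split.
  by have := pow2_ge_0 (alpha * C); Lra.lra.
move=> V E ends noloop cubG cyc4 e.
have [K [nK HK]] := grow V E ends e noloop cubG cyc4.
have nC : alpha * INR #|V| <= alpha * C * (INR K + 1) ^ 2.
  rewrite Rmult_assoc; apply: Rmult_le_compat_l; first by Lra.lra.
  apply: Rle_trans (INR_le (ltnW nK)) _; rewrite INR_expn -multE mult_INR Rpow_mult_distr S_INR.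
  by apply: Rmult_le_compat_r; [apply: pow2_ge_0|rewrite /C; Lra.lra].
have N0 : 0 <= INR (num_pm_avoiding ends e) by apply: pos_INR.
case: HK => [K0|HK].
  move: nC; rewrite K0 /=; have := pow2_ge_0 (alpha * C); Lra.lra.
have q := quadratic_below_exponential K aC.
suff : (21 / 20) ^ K <= INR (num_pm_avoiding ends e) by Lra.lra.
have := INR_le HK; rewrite -multE mult_INR !INR_expn.
have -> : INR 21 = 21 by rewrite /INR; Lra.lra.
have -> : INR 20 = 20 by rewrite /INR; Lra.lra.
move=> H; have p20 : 0 < 20 ^ K by apply: pow_lt; Lra.lra.
rewrite /Rdiv Rpow_mult_distr pow_inv; apply: (Rmult_le_reg_r (20 ^ K)) => //.
by rewrite Rmult_assoc Rinv_l ?Rmult_1_r //; Lra.lra.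
Qed.
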